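(* Let $(R,\mathfrak{m},k)$ be a (commutative) noetherian regular local ring of dimension $d$. Let $\mathsf{P}$, $\mathsf{I}$, $\mathsf{F}$ be the collections of all projective, injective, and flat $R$-modules, respectively. Then: (1) $\sup\{\operatorname{level}_R^{\mathsf{P}}(M) \mid M\in \mathsf{D}_{\mathsf{b}}(R)\} \le d+1$; (2) $\sup\{\operatorname{level}_R^{\mathsf{I}}(M) \mid M\in \mathsf{D}_{\mathsf{b}}(R)\} \le d+1$; (3) $\sup\{\operatorname{level}_R^{\mathsf{F}}(M) \mid M\in \mathsf{D}_{\mathsf{b}}(R)\} \le d+1$.
   Context: $\mathsf{D}(R)$ is the derived category of $R$; $\mathsf{D}_{\mathsf{b}}(R)$ is the full subcategory of complexes $M$ with bounded homology ($\mathrm{H}_i(M)=0$ for all $|i|\gg 0$); homology modules need not be finitely generated. Level: for a nonempty collection $\mathsf{C}$ of objects of $\mathsf{D}(R)$ (modules are viewed as complexes concentrated in degree $0$), set $\operatorname{thick}_R^0(\mathsf{C}) = \{0\}$; $\operatorname{thick}_R^1(\mathsf{C})$ is the smallest collection of objects containing $\mathsf{C}$ and closed under isomorphism, shifts, finite direct sums and direct summands; for $n\ge 2$, $\operatorname{thick}_R^n(\mathsf{C})$ consists of all $M\in \mathsf{D}(R)$ for which there is a distinguished triangle $K \to L\oplus M \to N \to$ (for some object $L$) with $K\in \operatorname{thick}_R^1(\mathsf{C})$ and $N \in \operatorname{thick}_R^{n-1}(\mathsf{C})$. Then $\operatorname{level}_R^{\mathsf{C}}(M) = \inf\{n \mid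 M\in \operatorname{thick}_R^n(\mathsf{C})\}$ (equal to $\infty$ if no such $n$ exists). *)

(* Defs.v *)
From HB Require Import structures.
From mathcomp Require Import all_boot all_order all_algebra.
From mathcomp Require Import boolp classical_sets reals ereal Rstruct.

Set Implicit Arguments.
Unset Strict Implicit.
Unset Printing Implicit Defensive.

Import Order.TTheory GRing.Theory Num.Theory.
Local Open Scope ring_scope.

(* Note that idealr_closed I states that I is a *proper* ideal. *)
Section LocalRings.
Variable R : comNzRingType.
Implicit Types (I m : {pred R}) (s : seq R).

Definition generates s I : Prop :=
  forall x, x \in I <-> exists c : nat -> R, x = \sum_(i < size s) c i * s`_i.

(* The unit ideal, which idealr_closed excludes, is generated by 1. *)
Definition noetherian : Prop :=
  forall I, idealr_closed I -> exists s, generates s I.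

Definition maximal_ideal m : Prop :=
  idealr_closed m /\
  forall I, idealr_closed I -> {subset m <= I} -> I =i m.

Definition local_ring m : Prop :=
  maximal_ideal m /\ forall I, maximal_ideal I -> I =i m.

Definition prime_ideal I : Prop := idealr_closed I /\ prime_idealr_closed I.

Definition prime_chain (n : nat) (p : nat -> {pred R}) : Prop :=
  (forall i, (i <= n)%N -> prime_ideal (p i)) /\
  (forall i, (i < n)%N ->
     {subset p i <= p i.+1} /\ ~ {subset p i.+1 <= p i}).

Definition has_krull_dim (d : nat) : Prop :=
  (exists p, prime_chain d p) /\
  (forall n p, prime_chain n p -> (n <= d)%N).

(* A noetherian local ring (R, m) of Krull dimension d is regular when m can
   be generated by d elements. *)
Definition regular_local_ring m (d : nat) : Prop :=
  [/\ noetherian, local_ring m, has_krull_dim d &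
      exists s, size s = d /\ generates s m].

End LocalRings.

Section Modules.
Variable R : comNzRingType.

Definition projective (P : lmodType R) : Prop :=
  forall (A B : lmodType R) (g : {linear A -> B}) (f : {linear P -> B}),
    (forall b, exists a, g a = b) ->
    exists h : {linear P -> A}, forall x, g (h x) = f x.

Definition injective_module (I : lmodType R) : Prop :=
  forall (A B : lmodType R) (g : {linear A -> B}) (f : {linear A -> I}),
    injective g -> exists h : {linear B -> I}, forall x, h (g x) = f x.

(* The tensor product of F and A is the set of finite formal sums of pairs
   (x, a), modulo the congruence tensor_eq generated by the bilinearity
   relations. *)
Inductive tensor_eq (F A : lmodType R) : seq (F * A) -> seq (F * A) -> Prop :=
| tensor_refl s : tensor_eq s s
| tensor_sym s t : tensor_eq s t -> tensor_eq t s
| tensor_trans s t u : tensor_eq s t -> tensor_eq t u -> tensor_eq s u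
| tensor_cat s s' t t' :
    tensor_eq s s' -> tensor_eq t t' -> tensor_eq (s ++ t) (s' ++ t')
| tensor_comm s t : tensor_eq (s ++ t) (t ++ s)
| tensor_addl x y a : tensor_eq [:: (x + y, a)] [:: (x, a); (y, a)]
| tensor_addr x a b : tensor_eq [:: (x, a + b)] [:: (x, a); (x, b)]
| tensor_scale r x a : tensor_eq [:: (r *: x, a)] [:: (x, r *: a)]
| tensor_zero : tensor_eq [:: (0, 0)] [::].

Definition tensor_map (F A B : lmodType R) (f : {linear A -> B})
  (s : seq (F * A)) : seq (F * B) := [seq (p.1, f p.2) | p <- s].

Definition flat (F : lmodType R) : Prop :=
  forall (A B : lmodType R) (f : {linear A -> B}), injective f ->
    forall s t : seq (F * A),
      tensor_eq (tensor_map f s) (tensor_map f t) -> tensor_eq s t.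

End Modules.

(* Homological indexing.  The differential is given between all pairs of
   degrees and vanishes unless it lowers the degree by one; this avoids
   transporting along equalities such as (i - n) - 1 = (i - 1) - n. *)
Record complex (R : comNzRingType) := Complex {
  obj :> int -> lmodType R;
  differential : forall i j : int, {linear obj i -> obj j};
  differential_shape : forall i j x, j != i - 1 -> differential i j x = 0;
  differentialK : forall i j k x, differential j k (differential i j x) = 0 }.

Arguments differential {R} c i j.

Record chain_map (R : comNzRingType) (X Y : complex R) := ChainMap {
  component :> forall i : int, {linear X i -> Y i};
  componentE : forall i j x, component j (differential X i j x) =
    differential Y i j (component i x) }.

Section Complexes.
Variable R : comNzRingType.
Implicit Types X Y Z : complex R.

Definition id_map X : chain_map X X :=
  @ChainMap R X X (fun i => idfun : {linear X i -> X i})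
    (fun i j x => erefl).

Definition comp_map_subproof X Y Z (g : chain_map Y Z) (f : chain_map X Y)
  i j x :
  (g j \o f j) (differential X i j x) = differential Z i j ((g i \o f i) x).
Proof. by rewrite /= !componentE. Qed.

Definition comp_map X Y Z (g : chain_map Y Z) (f : chain_map X Y) :
    chain_map X Z :=
  @ChainMap R X Z (fun i => g i \o f i : {linear X i -> Z i})
    (comp_map_subproof g f).

Definition cycle X i (x : X i) : Prop := forall j, differential X i j x = 0.
Definition boundary X i (x : X i) : Prop :=
  exists j y, differential X j i y = x.

(* Bijectivity of H_i(f) for every i. *)
Definition quasi_iso X Y (f : chain_map X Y) : Prop :=
  forall i,
    (forall x x' : X i, cycle x -> cycle x' ->
       boundary (f i x - f i x') -> boundary (x - x')) /\
    (forall y : Y i, cycle y ->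
       exists x : X i, cycle x /\ boundary (f i x - y)).

Definition bounded_homology X : Prop :=
  exists n : nat, forall (i : int) (x : X i),
    (n < `|i|)%N -> cycle x -> boundary x.

End Complexes.

Section Constructions.
Variable R : comNzRingType.
Implicit Types X Y : complex R.

Definition zero_module : lmodType R := 'rV[R]_0.

Definition stalk_obj (M : lmodType R) (i : int) : lmodType R :=
  if i == 0 then M else zero_module.

Definition stalk (M : lmodType R) : complex R :=
  @Complex R (stalk_obj M)
    (fun i j => \0 : {linear stalk_obj M i -> stalk_obj M j})
    (fun i j x _ => erefl) (fun i j k x => erefl).

Definition zero_complex : complex R := stalk zero_module.

Section DirectSum.
Variables X Y : complex R.

Definition dsum_diff i j (p : X i * Y i) : X j * Y j :=
  (differential X i j p.1, differential Y i j p.2).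

Lemma dsum_diff_linear i j : linear (@dsum_diff i j).
Proof. by move=> a p q; rewrite /dsum_diff /= !linearP. Qed.

HB.instance Definition _ i j :=
  GRing.isLinear.Build R (X i * Y i)%type (X j * Y j)%type _
    (@dsum_diff i j) (@dsum_diff_linear i j).

Lemma dsum_shape i j (p : X i * Y i) : j != i - 1 -> dsum_diff j p = 0.
Proof. by move=> ne; rewrite /dsum_diff !differential_shape. Qed.

Lemma dsum_diffK i j k (p : X i * Y i) : dsum_diff k (dsum_diff j p) = 0.
Proof. by rewrite /dsum_diff /= !differentialK. Qed.

Definition dsum : complex R :=
  @Complex R (fun i => (X i * Y i)%type : lmodType R)
    (fun i j => @dsum_diff i j) dsum_shape dsum_diffK.

End DirectSum.

Section Shift.
Variable n : int.

Section ShiftComplex.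
Variable X : complex R.

Definition shift_diff i j (x : X (i - n)) : X (j - n) :=
  (-1) ^+ `|n|%N *: differential X (i - n) (j - n) x.

Lemma shift_diff_linear i j : linear (@shift_diff i j).
Proof.
by move=> a x y; rewrite /shift_diff linearP scalerDr !scalerA mulrC.
Qed.

HB.instance Definition _ i j :=
  GRing.isLinear.Build R (X (i - n)) (X (j - n)) _
    (@shift_diff i j) (@shift_diff_linear i j).

Lemma shift_shape i j (x : X (i - n)) : j != i - 1 -> shift_diff j x = 0.
Proof.
move=> ne; rewrite /shift_diff differential_shape ?scaler0 //.
by rewrite addrAC (inj_eq (addIr _)).
Qed.

Lemma shift_diffK i j k (x : X (i - n)) : shift_diff k (shift_diff j x) = 0.
Proof. by rewrite /shift_diff linearZ /= differentialK !scaler0. Qed.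

(* (X[n])_i = X_(i-n), with differential (-1)^n d. *)
Definition shift : complex R :=
  @Complex R (fun i => X (i - n)) (fun i j => @shift_diff i j)
    shift_shape shift_diffK.

End ShiftComplex.

Variables (X Y : complex R) (f : chain_map X Y).

Lemma shift_map_subproof i j (x : shift X i) :
  f (j - n) (differential (shift X) i j x) =
  differential (shift Y) i j (f (i - n) x).
Proof. by rewrite /= /shift_diff linearZ /= componentE. Qed.

Definition shift_map : chain_map (shift X) (shift Y) :=
  @ChainMap R (shift X) (shift Y) (fun i => f (i - n)) shift_map_subproof.

Lemma shift_cycle Z i (x : shift Z i) :
  cycle x <-> @cycle R Z (i - n) x.
Proof.
split=> cx j; last by rewrite /= /shift_diff cx scaler0.
have := cx (j + n); rewrite /= /shift_diff.
move=> /(congr1 (fun y => (-1) ^+ `|n|%N *: y)).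
rewrite scalerA -expr2 sqrr_sign scale1r scaler0.
by rewrite addrK.
Qed.

Lemma shift_boundary Z i (x : shift Z i) :
  boundary x <-> @boundary R Z (i - n) x.
Proof.
split=> [[j [y <-]]|[j]].
  exists (j - n), ((-1) ^+ `|n|%N *: y).
  by rewrite linearZ.
rewrite -[j](addrK n) => -[y <-].
exists (j + n), ((-1) ^+ `|n|%N *: y).
by rewrite /= /shift_diff linearZ /= scalerA -expr2 sqrr_sign scale1r.
Qed.

Lemma shift_quasi_iso : quasi_iso f -> quasi_iso shift_map.
Proof.
move=> qf i; have [inj surj] := qf (i - n); split.
  move=> x x' /shift_cycle cx /shift_cycle cx' /shift_boundary b.
  exact/shift_boundary/inj.
move=> y /shift_cycle /surj[x [cx b]]; exists x.
by split; [exact/shift_cycle|exact/shift_boundary].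
Qed.

End Shift.

Definition transport X i j (x : X i) : X j :=
  match i =P j with
  | ReflectT e => eq_rect i (fun k => X k) x j e
  | ReflectF _ => 0
  end.

Lemma transport_id X i (x : X i) : transport i x = x.
Proof.
rewrite /transport; case: eqP => // e.
by rewrite (eq_axiomK e).
Qed.

Lemma transport_neq X i j (x : X i) : i != j -> transport j x = 0.
Proof. by rewrite /transport; case: eqP. Qed.

Lemma transport_linear X i j : linear (@transport X i j).
Proof.
move=> a x y; have [<-|ne] := eqVneq i j; first by rewrite !transport_id.
by rewrite !transport_neq // scaler0 addr0.
Qed.

HB.instance Definition _ X i j :=
  GRing.isLinear.Build R (X i) (X j) _
    (@transport X i j) (@transport_linear X i j).

Section Cone.
Variables (X Y : complex R) (f : chain_map X Y).

Definition cone_obj i : lmodType R := (X (i - 1) * Y i)%type.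

(* d (x, y) = (- d x, d y + f x); transport j only serves to view
   f x : Y_(i-1) as an element of Y_j when j = i - 1. *)
Definition cone_diff i j (p : cone_obj i) : cone_obj j :=
  (differential (shift 1 X) i j p.1,
   differential Y i j p.2 + transport j (f (i - 1) p.1)).

Lemma cone_diff_linear i j : linear (@cone_diff i j).
Proof.
move=> a p q; rewrite /cone_diff !linearP.
by congr pair; rewrite /= scalerDr addrACA.
Qed.

HB.instance Definition _ i j :=
  GRing.isLinear.Build R (cone_obj i) (cone_obj j) _
    (@cone_diff i j) (@cone_diff_linear i j).

Lemma cone_shape i j (p : cone_obj i) : j != i - 1 -> cone_diff j p = 0.
Proof.
move=> ne; rewrite /cone_diff !differential_shape // transport_neq ?addr0 //.
by rewrite eq_sym.
Qed.

Lemma cone_diffK i j k (p : cone_obj i) : cone_diff k (cone_diff j p) = 0.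
Proof.
have [->|ne] := eqVneq j (i - 1); last by rewrite (cone_shape p) // linear0.
rewrite {1}/cone_diff differentialK.
have [->|ne] := eqVneq k (i - 1 - 1); last first.
  rewrite differential_shape // transport_neq ?addr0 //.
  by rewrite eq_sym.
rewrite /cone_diff /= !transport_id linearD /= differentialK add0r.
by rewrite /shift_diff expr1 scaleN1r linearN /= componentE subrr.
Qed.

Definition cone : complex R :=
  @Complex R cone_obj (fun i j => @cone_diff i j) cone_shape cone_diffK.

Definition cone_in_fun i (y : Y i) : cone_obj i := (0, y).

Lemma cone_in_linear i : linear (@cone_in_fun i).
Proof. by move=> a x y; congr pair; rewrite /= scaler0 addr0. Qed.

HB.instance Definition _ i :=
  GRing.isLinear.Build R (Y i) (cone_obj i) _
    (@cone_in_fun i) (@cone_in_linear i).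

Lemma cone_in_subproof i j (y : Y i) :
  cone_in_fun (differential Y i j y) = differential cone i j (cone_in_fun y).
Proof.
rewrite /= /cone_diff /cone_in_fun /= !linear0.
by rewrite addr0.
Qed.

Definition cone_in : chain_map Y cone :=
  @ChainMap R Y cone (fun i => @cone_in_fun i) cone_in_subproof.

Definition cone_out : chain_map cone (shift 1 X) :=
  @ChainMap R cone (shift 1 X)
    (fun i => fst : {linear cone_obj i -> X (i - 1)})
    (fun i j p => erefl).

End Cone.
End Constructions.

(* The derived category, as the localization of the category of complexes at
   the quasi-isomorphisms: morphisms X -> Y are formal composites of chain maps
   and of inverses of quasi-isomorphisms, modulo the congruence deq. *)
Inductive dmor (R : comNzRingType) : complex R -> complex R -> Type :=
| dmap X Y (f : chain_map X Y) : dmor X Y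
| dinv X Y (f : chain_map X Y) (qf : quasi_iso f) : dmor Y X
| dcomp X Y Z (g : dmor Y Z) (f : dmor X Y) : dmor X Z.

Definition did (R : comNzRingType) (X : complex R) : dmor X X :=
  dmap (id_map X).

Inductive deq (R : comNzRingType) :
  forall X Y : complex R, dmor X Y -> dmor X Y -> Prop :=
| deq_refl X Y (f : dmor X Y) : deq f f
| deq_sym X Y (f g : dmor X Y) : deq f g -> deq g f
| deq_trans X Y (f g h : dmor X Y) : deq f g -> deq g h -> deq f h
| deq_comp X Y Z (g g' : dmor Y Z) (f f' : dmor X Y) :
    deq g g' -> deq f f' -> deq (dcomp g f) (dcomp g' f')
| deq_assoc X Y Z T (h : dmor Z T) (g : dmor Y Z) (f : dmor X Y) :
    deq (dcomp h (dcomp g f)) (dcomp (dcomp h g) f)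
| deq_idl X Y (f : dmor X Y) : deq (dcomp (did Y) f) f
| deq_idr X Y (f : dmor X Y) : deq (dcomp f (did X)) f
| deq_map X Y (f g : chain_map X Y) :
    (forall i x, f i x = g i x) -> deq (dmap f) (dmap g)
| deq_map_comp X Y Z (g : chain_map Y Z) (f : chain_map X Y) :
    deq (dmap (comp_map g f)) (dcomp (dmap g) (dmap f))
| deq_invl X Y (f : chain_map X Y) (qf : quasi_iso f) :
    deq (dcomp (dinv qf) (dmap f)) (did X)
| deq_invr X Y (f : chain_map X Y) (qf : quasi_iso f) :
    deq (dcomp (dmap f) (dinv qf)) (did Y).

Section DerivedCategory.
Variable R : comNzRingType.
Implicit Types (X Y K L M N : complex R) (C : complex R -> Prop).

Fixpoint dshift (n : int) X Y (f : dmor X Y) : dmor (shift n X) (shift n Y) :=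
  match f with
  | dmap _ _ f => dmap (shift_map n f)
  | dinv _ _ _ qf => dinv (shift_quasi_iso n qf)
  | dcomp _ _ _ g f => dcomp (dshift n g) (dshift n f)
  end.

Definition d_isom X Y (f : dmor X Y) : Prop :=
  exists g : dmor Y X, deq (dcomp g f) (did X) /\ deq (dcomp f g) (did Y).

Definition d_isomorphic X Y : Prop := exists f : dmor X Y, d_isom f.

(* Triangles K -> M -> N -> K[1] isomorphic in the derived category to
   A -> B -> cone f -> A[1] for some chain map f : A -> B. *)
Definition distinguished K M N (u : dmor K M) (v : dmor M N)
  (w : dmor N (shift 1 K)) : Prop :=
  exists A B (f : chain_map A B)
    (a : dmor K A) (b : dmor M B) (c : dmor N (cone f)),
    [/\ d_isom a, d_isom b & d_isom c] /\
    [/\ deq (dcomp b u) (dcomp (dmap f) a),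
        deq (dcomp c v) (dcomp (dmap (cone_in f)) b) &
        deq (dcomp (dshift 1 a) w) (dcomp (dmap (cone_out f)) c)].

Inductive thick1 C : complex R -> Prop :=
| thick1_in X : C X -> thick1 C X
| thick1_iso X Y : d_isomorphic X Y -> thick1 C X -> thick1 C Y
| thick1_shift n X : thick1 C X -> thick1 C (shift n X)
| thick1_zero : thick1 C (zero_complex R)
| thick1_sum X Y : thick1 C X -> thick1 C Y -> thick1 C (dsum X Y)
| thick1_summand X Y : thick1 C (dsum X Y) -> thick1 C X.

(* thick C 0 is {0}, i.e. the zero objects of the derived category. *)
Fixpoint thick C (n : nat) (M : complex R) : Prop :=
  match n with
  | 0 => d_isomorphic M (zero_complex R)
  | 1 => thick1 C M
  | n'.+1 =>
      exists K L N (u : dmor K (dsum L M)) (v : dmor (dsum L M) N)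
        (w : dmor N (shift 1 K)),
        [/\ distinguished u v w, thick1 C K & thick C n' N]
  end.

Local Open Scope classical_set_scope.

(* Levels take values in the extended reals over Stdlib's R; the infimum of
   the empty set is +oo. *)
Definition level C (M : complex R) : \bar Rdefinitions.R :=
  ereal_inf [set (n%:R)%:E | n in [set n : nat | thick C n M]].

Definition in_degree_zero (P : lmodType R -> Prop) : complex R -> Prop :=
  fun X => exists2 M, P M & X = stalk M.

(* Not an image [set _ | M in _]: the universe of the library's image is too
   small for the type of complexes. *)
Definition sup_level (P : lmodType R -> Prop) : \bar Rdefinitions.R :=
  ereal_sup [set l | exists2 M, bounded_homology M &
                       level (in_degree_zero P) M = l].

End DerivedCategory.

(* Main.v *)
(** Over a regular local ring of dimension d, write the maximal ideal as
    (x_1, ..., x_d).  By Krull's principal ideal theorem, a prime chain of length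
    d forces each ideal (x_1, ..., x_j) to be prime, so x_1, ..., x_d is a regular
    sequence.  Each step of a minimal free resolution of R/I lengthens the initial
    segment of x_1, ..., x_d that is regular on the cokernel, and a finitely
    generated module on which the whole sequence is regular is free.  Hence
    R/I has projective dimension at most d; by Baer's criterion and dimension
    shifting every d-th cosyzygy is injective, and then every d-th syzygy is
    projective.

    A complex M with bounded homology is resolved by the projective dimension
    of its homology: if P is a finite sum of shifts of projectives mapping to M
    surjectively in homology, the homology of the cone consists of shifted first
    syzygies of the homology of M, and when the homology is projective M is
    isomorphic to its homology.  The injective case is dual, with homotopy
    fibres instead of cones.  Projective modules are flat, which settles the
    last bound. *)
Require Import Defs.
From HB Require Import structures.
From mathcomp Require Import all_boot all_order all_algebra.
From mathcomp Require Import boolp classical_sets functions reals ereal Rstruct.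
From mathcomp Require Import freeg ring zify.
Import Defs.
Set Implicit Arguments.
Unset Strict Implicit.
Unset Printing Implicit Defensive.
Import Order.TTheory GRing.Theory Num.Theory.
Local Open Scope ring_scope.

(** * Modules *)

(** Minimal resolutions and Nakayama arguments need finite generation, but the modules of the
    statement are arbitrary. Baer's criterion is the bridge: injectivity is tested on ideals alone,
    which are finitely generated here, so the bound for the modules R/I reaches every injective
    dimension, and from there every projective one.

    Ext is never constructed. The vanishing of Ext^1(coker f, C) is stated as an extension property
    of maps, and two lemmas shift it along syzygies and cosyzygies. Likewise homology stays a pair
    of predicates, cycles modulo boundaries, and localizations are replaced by saturated ideals of
    R.

    The constant d + 1 counts the modules in a resolution of length d, each giving one layer of
    [thick1]. The last layer exists because a map from a projective module to homology lifts to the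
    cycles, while a map from homology to an injective module extends from the cycles to the whole
    component; so projective or injective homology splits off. *)

Definition is_submodule (R : comNzRingType) (A : lmodType R) (S : A -> Prop) :=
  S 0 /\ forall a x y, S x -> S y -> S (a *: x + y).

Section SubmoduleTheory.
Variables (R : comNzRingType) (A : lmodType R) (S : A -> Prop).
Hypothesis subS : is_submodule S.

Lemma submod0 : S 0. Proof. by case: subS. Qed.

Lemma submodD x y : S x -> S y -> S (x + y).
Proof. by move=> Sx Sy; rewrite -[x]scale1r; apply: subS.2. Qed.

Lemma submodZ a x : S x -> S (a *: x).
Proof. by move=> Sx; rewrite -[_ *: _]addr0; apply: subS.2 => //; apply: subS.1. Qed.

Lemma submodN x : S x -> S (- x).
Proof. by rewrite -scaleN1r; apply: submodZ. Qed.

Lemma submodB x y : S x -> S y -> S (x - y).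
Proof. by move=> Sx Sy; apply/submodD/submodN. Qed.

Lemma submod_sum I (r : seq I) (P : pred I) (F : I -> A) :
  (forall i, P i -> S (F i)) -> S (\sum_(i <- r | P i) F i).
Proof. by move=> h; elim/big_ind: _ => //; [exact: submod0|exact: submodD]. Qed.

End SubmoduleTheory.

Section LinearMaps.
Variable R : comNzRingType.
Implicit Types A B C : lmodType R.

Lemma exists_linear A B (f : A -> B) :
  linear f -> exists g : {linear A -> B}, forall x, g x = f x.
Proof.
move=> lf; pose L := GRing.isLinear.Build R A B _ f lf.
by exists (HB.pack f L : {linear A -> B}).
Qed.

Lemma linear_factor_mono A B C (f : {linear A -> B}) (i : {linear C -> B}) :
  injective i -> (forall x, exists c, i c = f x) ->
  exists h : {linear A -> C}, forall x, i (h x) = f x.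
Proof.
move=> inj_i ex; have [g gE] := choice ex.
have lg : linear g.
  by move=> a x y; apply: inj_i; rewrite linearP !gE linearP.
by have [h hE] := exists_linear lg; exists h => x; rewrite hE.
Qed.

Lemma linear_factor_epi A B C (f : {linear A -> B}) (p : {linear A -> C}) :
  (forall c, exists x, p x = c) -> (forall x, p x = 0 -> f x = 0) ->
  exists h : {linear C -> B}, forall x, h (p x) = f x.
Proof.
move=> ex ker; have [s sE] := choice ex.
have E x y : p x = p y -> f x = f y.
  move=> e; apply/eqP; rewrite -subr_eq0 -linearB; apply/eqP/ker.
  by rewrite linearB /= e subrr.
have ls : linear (fun c => f (s c)).
  by move=> a x y; rewrite -linearP; apply: E; rewrite linearP !sE.
by have [h hE] := exists_linear ls; exists h => x; rewrite hE; apply: E; rewrite sE.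
Qed.

Lemma ker_submodule A B (f : {linear A -> B}) (S : B -> Prop) :
  is_submodule S -> is_submodule (fun x => S (f x)).
Proof.
move=> subS; split=> [|a x y Sx Sy]; rewrite ?linear0 ?linearP.
  exact: subS.1.
exact: subS.2.
Qed.

Lemma image_submodule A B (f : {linear A -> B}) (S : A -> Prop) :
  is_submodule S -> is_submodule (fun y => exists2 x, S x & f x = y).
Proof.
move=> subS; split; first by exists 0; rewrite ?linear0 //; exact: subS.1.
move=> a _ _ [x Sx <-] [y Sy <-]; exists (a *: x + y); last by rewrite linearP.
exact: subS.2.
Qed.

Lemma zero_submodule A : is_submodule (fun x : A => x = 0).
Proof. by split=> // a x y -> ->; rewrite scaler0 addr0. Qed.

Lemma full_submodule A : is_submodule (fun _ : A => True).
Proof. by []. Qed.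

End LinearMaps.

Section Submodule.
Variables (R : comNzRingType) (A : lmodType R) (S : A -> Prop).
Hypothesis subS : is_submodule S.

Let p : pred A := fun x => `[< S x >].

Let p_closed : GRing.subsemimod_closed p.
Proof.
split; first split.
- by apply/asboolP; exact: subS.1.
- by move=> x y /asboolP Sx /asboolP Sy; apply/asboolP; exact: submodD.
by move=> a x /asboolP Sx; apply/asboolP; exact: submodZ.
Qed.

(** The proof is a parameter of the type because the module instance depends on it and inference
    must read it off the type. *)
Definition submodule_of of is_submodule S := {x : A | p x}.
Local Notation sub := (submodule_of subS).
HB.instance Definition _ := Choice.on sub.
HB.instance Definition _ := SubType.on sub.
HB.instance Definition _ :=
  GRing.SubChoice_isSubLmodule.Build R A p sub p_closed.

Lemma submodule_exists : exists (M : lmodType R) (i : {linear M -> A}),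
  injective i /\ forall x, S x <-> exists m, i m = x.
Proof.
exists sub, (\val : {linear sub -> A}); split; first exact: val_inj.
move=> x; split=> [Sx|[m <-]]; last by case: m => m /= /asboolP.
by exists (exist _ x (asboolT Sx)).
Qed.

End Submodule.

Section Quotient.
Local Open Scope quotient_scope.
Variables (R : comNzRingType) (A : lmodType R) (S : A -> Prop).
Hypothesis subS : is_submodule S.

Let e : rel A := fun x y => `[< S (x - y) >].

Let e_refl : reflexive e.
Proof. by move=> x; apply/asboolP; rewrite subrr; exact: subS.1. Qed.

Let e_sym : symmetric e.
Proof.
move=> x y; apply/asboolP/asboolP => h; rewrite -opprB; exact: submodN.
Qed.

Let e_trans : transitive e.
Proof.
move=> y x z /asboolP h /asboolP h'; apply/asboolP.
by rewrite -(subrK y x) -addrA; apply: submodD.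
Qed.

Let eR := EquivRel e e_refl e_sym e_trans.

Definition quotient_of of is_submodule S := {eq_quot eR}.
Local Notation Q := (quotient_of subS).
HB.instance Definition _ := Choice.on Q.
HB.instance Definition _ := EqQuotient.on Q.

Let pi (x : A) : Q := \pi_Q x.
Let rep (q : Q) : A := repr q.
Let piK q : pi (rep q) = q. Proof. exact: reprK. Qed.

Let piE (x y : A) : (pi x = pi y) <-> S (x - y).
Proof.
split=> [h|h]; last by apply/eqmodP/asboolP.
by have /eqmodP/asboolP := h.
Qed.

Let qadd (x y : Q) : Q := pi (rep x + rep y).
Let qopp (x : Q) : Q := pi (- rep x).
Let qscale a (x : Q) : Q := pi (a *: rep x).

Let reprP x : S (rep (pi x) - x).
Proof. by apply/piE; rewrite piK. Qed.

Let qaddE x y : qadd (pi x) (pi y) = pi (x + y).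
Proof. by apply/piE; rewrite opprD addrACA; apply: submodD => //; apply: reprP. Qed.

Let qoppE x : qopp (pi x) = pi (- x).
Proof. by apply/piE; rewrite -opprD; apply: submodN => //; apply: reprP. Qed.

Let qscaleE a x : qscale a (pi x) = pi (a *: x).
Proof. by apply/piE; rewrite -scalerBr; apply: submodZ => //; apply: reprP. Qed.

Let qaddA : associative qadd.
Proof.
move=> x y z.
rewrite -[x]piK.
rewrite -[y]piK -[z]piK.
by rewrite !qaddE addrA.
Qed.

Let qaddC : commutative qadd.
Proof. by move=> x y; rewrite -[x]piK; rewrite -[y]piK; rewrite !qaddE addrC. Qed.

Let qadd0 : left_id (pi 0) qadd.
Proof. by move=> x; rewrite -[x]piK; rewrite !qaddE add0r. Qed.

Let qaddN : left_inverse (pi 0) qopp qadd.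
Proof. by move=> x; rewrite -[x]piK; rewrite qoppE qaddE addNr. Qed.

HB.instance Definition _ := GRing.isZmodule.Build Q qaddA qaddC qadd0 qaddN.

Let qscaleA a b v : qscale a (qscale b v) = qscale (a * b) v.
Proof. by rewrite -[v]piK; rewrite !qscaleE scalerA. Qed.

Let qscale1 : left_id 1 qscale.
Proof. by move=> x; rewrite -[x]piK; rewrite qscaleE scale1r. Qed.

Let qscaleDr : right_distributive qscale +%R.
Proof.
move=> a x y; rewrite -[x]piK; rewrite -[y]piK.
by rewrite [_ + _]qaddE !qscaleE [RHS]qaddE scalerDr.
Qed.

Let qscaleDl v : {morph qscale^~ v : a b / a + b >-> a + b}.
Proof. by move=> a b; rewrite -[v]piK; rewrite !qscaleE [RHS]qaddE scalerDl. Qed.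

HB.instance Definition _ :=
  GRing.Zmodule_isLmodule.Build R Q qscaleA qscale1 qscaleDr qscaleDl.

Lemma quotient_exists : exists (M : lmodType R) (p : {linear A -> M}),
  (forall m, exists x, p x = m) /\ forall x, p x = 0 <-> S x.
Proof.
have lp : linear (fun x => pi x : Q).
  by move=> a x y; rewrite [RHS](_ : _ = qadd (qscale a (pi x)) (pi y)) // qscaleE qaddE.
have [p pE] := exists_linear lp.
exists Q, p; split; first by move=> m; exists (rep m); rewrite pE piK.
move=> x; rewrite pE -[x in S x]subr0.
exact: piE.
Qed.

End Quotient.

(** * Projective modules and free covers *)

Section Projective.
Variable R : comNzRingType.
Implicit Types A B P : lmodType R.

(** Corestricting both maps to the image of [g] makes [g] surjective. In this form a map into the
    boundaries lifts through a differential. *)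
Lemma projective_lift A B P (g : {linear A -> B}) (f : {linear P -> B}) :
  projective P -> (forall x, exists a, g a = f x) ->
  exists h : {linear P -> A}, forall x, g (h x) = f x.
Proof.
move=> projP ex.
have [I [i [inj_i iE]]] := submodule_exists (image_submodule g (full_submodule A)).
have [|g' g'E] := @linear_factor_mono _ _ _ _ g i inj_i.
  by move=> a; apply/iE; exists a.
have [|f' f'E] := @linear_factor_mono _ _ _ _ f i inj_i.
  by move=> x; apply/iE; have [a <-] := ex x; exists a.
have [|h hE] := projP _ _ g' f'.
  move=> b; have /iE[a _ ab] : exists m, i m = i b by exists b.
  by exists a; apply: inj_i; rewrite g'E.
by exists h => x; rewrite -g'E hE f'E.
Qed.

Lemma retract_projective P A (i : {linear P -> A}) (r : {linear A -> P}) :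
  (forall x, r (i x) = x) -> projective A -> projective P.
Proof.
move=> rK projA B C g f surj_g.
have [h hE] := projA _ _ g (f \o r : {linear _ -> _}) surj_g.
by exists (h \o i : {linear _ -> _}) => x; rewrite /= hE /= rK.
Qed.

Lemma zero_module_eq0 (x : zero_module R) : x = 0.
Proof. by apply/rowP => -[]. Qed.

Lemma zero_projective : projective (zero_module R).
Proof.
move=> A B g f _; exists \0 => x /=.
by rewrite linear0 (zero_module_eq0 x) linear0.
Qed.

Lemma exists_row_map n A (a : 'I_n -> A) :
  exists f : {linear 'rV[R]_n -> A}, forall x, f x = \sum_i x 0 i *: a i.
Proof.
apply: exists_linear => c x y.
rewrite scaler_sumr -big_split; apply: eq_bigr => i _ /=.
by rewrite !mxE scalerDl scalerA.
Qed.

Lemma row_map_sum n A (f : {linear 'rV[R]_n -> A}) x :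
  f x = \sum_i x 0 i *: f (delta_mx 0 i).
Proof.
by rewrite {1}[x]row_sum_delta linear_sum; apply: eq_bigr => i _; rewrite linearZ.
Qed.

Lemma row_projective n : projective ('rV[R]_n : lmodType R).
Proof.
move=> A B g f surj_g.
have [a aE] := choice (fun i : 'I_n => surj_g (f (delta_mx 0 i))).
have [h hE] := exists_row_map a; exists h => x.
rewrite hE linear_sum (row_map_sum f); apply: eq_bigr => i _.
by rewrite linearZ /= aE.
Qed.

Lemma exists_free_map (K : choiceType) A (a : K -> A) :
  exists f : {linear {freeg K / R} -> A},
    (forall x, f << x >> = a x) /\
    (forall D, f D = \sum_(x <- dom D) coeff x D *: a x).
Proof.
pose L := GRing.isZmodMorphism.Build _ _ (fglift a) (lift_is_additive a).
pose F : {additive {freeg K / R} -> A} := HB.pack (fglift a) L.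
have FE D : fglift a D = F D by [].
have E D : fglift a D = \sum_(x <- dom D) coeff x D *: a x.
  rewrite -{1}[D]freeg_sumE; elim: (dom D) => [|x s IH].
    by rewrite !big_nil FE raddf0.
  by rewrite !big_cons -IH !FE raddfD /= liftU.
(* [fglift] comes with additivity only; homogeneity is checked on the expansion of [x] in
   generators. *)
have lin : linear (fglift a).
  move=> c x y; rewrite !FE raddfD -!FE; congr (_ + _).
  rewrite [in RHS]E -{1}[x]freeg_sumE; elim: (dom x) => [|z s IH].
    by rewrite !big_nil !scaler0 FE raddf0.
  rewrite !big_cons !scalerDr FE raddfD -!FE IH scalerA -(liftU a); congr (fglift a _ + _).
  apply/eqP/freeg_eqP => w; rewrite coeff_fgscale !coeffU.
  by rewrite mulrA.
have [f fE] := exists_linear lin.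
by exists f; split=> ?; rewrite fE ?liftU ?scale1r ?E.
Qed.

Lemma free_projective (K : choiceType) : projective ({freeg K / R} : lmodType R).
Proof.
move=> A B g f surj_g.
have [a aE] := choice (fun x : K => surj_g (f << x >>)).
have [h [_ hE]] := exists_free_map a; exists h => D.
rewrite hE -[in RHS](freeg_sumE D) !linear_sum; apply: eq_bigr => x _.
rewrite linearZ /= aE -linearZ; congr (f _).
by apply/eqP/freeg_eqP => w; rewrite coeff_fgscale !coeffU mul1r.
Qed.

Lemma enough_projectives A :
  exists P (p : {linear P -> A}), projective P /\ forall x, exists y, p y = x.
Proof.
have [f [fE _]] := exists_free_map (fun x : A => x).
exists {freeg A / R}, f; split; first exact: free_projective.
by move=> x; exists << x >>.
Qed.

End Projective.

(** * Injective modules and the vanishing of Ext^1 *)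

Section Injective.
Variable R : comNzRingType.
Implicit Types A B C E X Y : lmodType R.

(** Maps from the image of [f] to [B] extend to [Y]. For projective [Y] this says that Ext^1(coker
    f, B) = 0. *)
Definition extends_along X Y (f : {linear X -> Y}) B :=
  forall phi : {linear X -> B}, (forall x, f x = 0 -> phi x = 0) ->
  exists psi : {linear Y -> B}, forall x, psi (f x) = phi x.

Lemma injective_extends X Y (f : {linear X -> Y}) E :
  injective_module E -> extends_along f E.
Proof.
move=> injE phi ker.
have [I [i [inj_i iE]]] := submodule_exists (image_submodule f (full_submodule X)).
have [|q qE] := @linear_factor_mono _ _ _ _ f i inj_i.
  by move=> x; apply/iE; exists x.
have [||h hE] := @linear_factor_epi _ _ _ _ phi q.
- move=> c; have /iE[x _ xc] : exists m, i m = i c by exists c.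
  by exists x; apply: inj_i; rewrite qE.
- by move=> x qx0; apply: ker; rewrite -qE qx0 linear0.
have [k kE] := injE _ _ i h inj_i.
by exists k => x; rewrite -qE kE hE.
Qed.

Definition exact_at X' X Y (f' : {linear X' -> X}) (f : {linear X -> Y}) :=
  forall x, f x = 0 <-> exists x', f' x' = x.

Definition cosyzygy B C :=
  exists E (i : {linear B -> E}) (p : {linear E -> C}),
    [/\ injective_module E, injective i, forall c, exists e, p e = c &
        forall e, p e = 0 <-> exists b, i b = e].

(* Together with the next lemma, this is the dimension shift
   Ext(coker f, C) = Ext(coker f', B), both groups being a second Ext of coker f
   and B. *)
Lemma extends_along_cosyzygy X' X Y (f' : {linear X' -> X})
    (f : {linear X -> Y}) B C :
  exact_at f' f -> cosyzygy B C -> projective X ->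
  extends_along f' B -> extends_along f C.
Proof.
move=> ex [E [i [p [injE inj_i surj_p kerp]]]] projX ext phi ker.
have [|e eE] := @projective_lift _ _ _ _ p phi projX.
  by move=> x; exact: surj_p.
have [|th thE] := @linear_factor_mono _ _ _ _ (e \o f' : {linear _ -> _}) i inj_i.
  by move=> x; apply/kerp; rewrite /= eE ker //; apply/ex; exists x.
have [|psi psiE] := ext th.
  by move=> x fx; apply: inj_i; rewrite thE /= fx !linear0.
(* The correction [i (psi x)] dies under [p], and the difference vanishes on the kernel of [f], so
   it extends along [f] into the injective [E]. *)
have lin : linear (fun x => e x - i (psi x)).
  by move=> a x y; rewrite !linearP /= scalerDr addrACA.
have [g gE] := exists_linear lin.
have [|h hE] := injective_extends injE (f := f) (phi := g).
  by move=> x /ex[x' <-]; rewrite gE psiE thE subrr.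
exists (p \o h : {linear _ -> _}) => x.
rewrite /= hE gE linearB /= eE.
by have /kerp-> : exists b, i b = i (psi x); [exists (psi x)|rewrite subr0].
Qed.

Lemma extends_along_syzygy X' X Y (f' : {linear X' -> X})
    (f : {linear X -> Y}) B C :
  exact_at f' f -> cosyzygy B C -> projective Y ->
  extends_along f C -> extends_along f' B.
Proof.
move=> ex [E [i [p [injE inj_i surj_p kerp]]]] projY ext phi ker.
have [|e eE] := injective_extends injE (f := f') (phi := i \o phi : {linear _ -> _}).
  by move=> x fx; rewrite /= ker // linear0.
have [|psi psiE] := ext (p \o e : {linear _ -> _}).
  by move=> x /ex[x' <-]; rewrite /= eE; apply/kerp; exists (phi x').
have [|h hE] := @projective_lift _ _ _ _ p psi projY.
  by move=> y; exact: surj_p.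
(* Both terms have the same image under [p], so the difference lands in [B]; on the image of [f']
   the term [h (f x)] is zero. *)
have lin : linear (fun x => e x - h (f x)).
  by move=> a x y; rewrite !linearP /= scalerDr addrACA.
have [g gE] := exists_linear lin.
have [|chi chiE] := @linear_factor_mono _ _ _ _ g i inj_i.
  by move=> x; apply/kerp; rewrite gE linearB /= hE psiE subrr.
exists chi => x; apply: inj_i; rewrite chiE gE eE.
by have /ex-> : exists y, f' y = f' x; [exists x|rewrite linear0 subr0].
Qed.

End Injective.

Section Baer.
Variable R : comNzRingType.
Implicit Types A B E : lmodType R.

(* Partial linear maps from R to E, whose domain is an ideal, are represented
   by their graphs. *)
Definition baer E := forall G : R -> E -> Prop,
  G 0 0 ->
  (forall a r s x y, G r x -> G s y -> G (a * r + s) (a *: x + y)) ->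
  (forall x, G 0 x -> x = 0) ->
  exists e, forall r x, G r x -> x = r *: e.

Lemma baer_injective E : baer E -> injective_module E.
Proof.
move=> baerE A B g f inj_g.
pose graph (X : set (B * E)) := [/\ is_submodule (X : (B * E)%type -> Prop),
  forall y, X (0, y) -> y = 0 & forall a, X (g a, f a)].
pose P (X : set (B * E)) := X = set0 \/ graph X.
have graphP : graph (fun p => exists a, p = (g a, f a)).
  split.
  - split=> [|c _ _ [a ->] [a' ->]].
      by exists 0; rewrite !linear0.
    by exists (c *: a + a'); rewrite !linearP.
  - move=> y [a [ga0 ->]]; suff -> : a = 0 by rewrite linear0.
    by apply: inj_g; rewrite -ga0 linear0.
  - by move=> a; exists a.
have [|X [PX maxX]] := @Zorn_bigcup (B * E)%type P.
  move=> F FP totF.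
  have [[X0 [FX0 gX0]]|none] := pselect (exists X, F X /\ graph X); last first.
    left; rewrite predeqE => p; split=> // -[X FX Xp].
    have [X0|gX] := FP X FX; first by rewrite X0 in Xp.
    by apply: none; exists X.
  have gr X p : F X -> X p -> graph X.
    by move=> FX Xp; have [X0'|//] := FP X FX; rewrite X0' in Xp.
  right; split.
  - split; first by exists X0 => //; have [[]] := gX0.
    move=> a p q [X FX Xp] [Y FY Yq].
    have [XY|YX] := totF X Y FX FY.
      by exists Y => //; have [[_ h] _ _] := gr _ _ FY Yq; apply: h => //; exact: XY.
    by exists X => //; have [[_ h] _ _] := gr _ _ FX Xp; apply: h => //; exact: YX.
  - by move=> y [X FX Xy]; have [_ h _] := gr _ _ FX Xy; exact: h.
  - by move=> a; exists X0 => //; have [_ _ h] := gX0; exact: h.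
have {PX} [subX funX gX] : graph X.
  have [X0|//] := PX; exfalso.
  apply: (maxX _ _ (or_intror graphP)); rewrite X0; split=> // h.
  by have := h (0, 0) (ex_intro _ 0 _); apply; rewrite !linear0.
have total b : exists e, X (b, e).
  apply: contrapT => nb.
  (* The test ideal consists of the [r] with [r *: b] in the domain of the maximal extension; [e] is
     then a consistent value at [b]. *)
  have [|||e eE] := baerE (fun r x => X (r *: b, x)).
  - by rewrite scale0r; exact: submod0 subX.
  - move=> a r s x y Xr Xs.
    have := subX.2 a _ _ Xr Xs; congr (X (_, _)).
    by rewrite /= scalerDl scalerA.
  - by move=> x; rewrite scale0r; exact: funX.
  pose Y (p : B * E) := exists r q, X q /\ p = (r *: b + q.1, r *: e + q.2).
  apply: (maxX Y); last right.
    split=> [p Xp|h].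
      by exists 0, p; split=> //; rewrite !scale0r !add0r -surjective_pairing.
    apply: nb; exists e; apply: h; exists 1, (0, 0).
    by rewrite !scale1r !addr0; split=> //; exact: submod0 subX.
  split.
  - split; first by exists 0, (0, 0); rewrite !scale0r !addr0; split=> //; exact: submod0 subX.
    move=> a _ _ [r [q [Xq ->]]] [s [q' [Xq' ->]]].
    exists (a * r + s), (a *: q + q'); split; first exact: subX.2.
    by congr pair; rewrite /= !scalerDl !scalerDr !scalerA addrACA.
  - move=> y [r [[q1 q2] [Xq [/esym /eqP]]]] /=.
    rewrite addrC addr_eq0 => /eqP q1E ->.
    have : X (r *: b, - q2).
      have := submodN subX Xq; congr (X (_, _)); rewrite /= q1E ?opprK //.
    by move=> /eE q2E; rewrite -q2E addNr.
  - move=> a; exists 0, (g a, f a); rewrite !scale0r !add0r; split=> //.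
have [h hE] := choice total.
have uniqX b e e' : X (b, e) -> X (b, e') -> e = e'.
  move=> Xe Xe'; apply/eqP; rewrite -subr_eq0; apply/eqP/funX.
  have := submodB subX Xe Xe'; congr (X (_, _)).
  by rewrite /= subrr.
have lin : linear h.
  move=> a x y; apply: (uniqX (a *: x + y)) => //.
  exact: (subX.2 a _ _ (hE x) (hE y)).
have [k kE] := exists_linear lin.
by exists k => a; rewrite kE; apply: (uniqX (g a)).
Qed.

End Baer.

(** * Enough injectives, by coinduction from divisible groups *)

Section Coinduction.
Variables (R : comNzRingType) (D : zmodType).

Let F : zmodType := (R -> D)%type.
Let additive_pred : pred F := fun f => `[< GRing.zmod_morphism f >].

Let additive_closed : @GRing.zmod_closed F additive_pred.
Proof.
split=> [|f g /asboolP af /asboolP ag]; apply/asboolP => x y.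
  by rewrite subr0.
by rewrite /= -!/(_ - _) [LHS](_ : _ = f (x - y) - g (x - y)) // af ag !opprD !opprK addrACA.
Qed.

(** Hom_Z(R, D), to be given the action (a f)(r) = f(r a). Coinduction is right adjoint to
    restriction of scalars to the integers. *)
Definition coinduced := {f : F | additive_pred f}.
HB.instance Definition _ := Choice.on coinduced.
HB.instance Definition _ := SubType.on coinduced.
HB.instance Definition _ :=
  GRing.SubChoice_isSubZmodule.Build F additive_pred coinduced
    additive_closed.

Lemma coinducedP (f : coinduced) : GRing.zmod_morphism (val f).
Proof. exact/asboolP/(valP f). Qed.

Lemma coinducedD (f : coinduced) r s : val f (r + s) = val f r + val f s.
Proof.
pose L := GRing.isZmodMorphism.Build _ _ (val f) (coinducedP f).
exact: (raddfD (HB.pack (val f) L : {additive R -> D})).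
Qed.

Definition Coinduced (f : R -> D) (add : GRing.zmod_morphism f) : coinduced :=
  Sub f (asboolT add).

Let scale_proof a (f : coinduced) : GRing.zmod_morphism (fun r => val f (r * a)).
Proof. by move=> x y; rewrite mulrBl coinducedP. Qed.

Let scale a (f : coinduced) : coinduced := Coinduced (scale_proof a f).

Let scaleA a b f : scale a (scale b f) = scale (a * b) f.
Proof. by apply/val_inj/funext => r /=; rewrite mulrA. Qed.

Let scale1 : left_id 1 scale.
Proof. by move=> f; apply/val_inj/funext => r /=; rewrite mulr1. Qed.

Let scaleDr : right_distributive scale +%R.
Proof. by move=> a f g; apply/val_inj/funext => r. Qed.

Let scaleDl f : {morph scale^~ f : a b / a + b}.
Proof.
move=> a b; apply/val_inj/funext => r.
by rewrite [LHS]/= mulrDr coinducedD.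
Qed.

HB.instance Definition _ :=
  GRing.Zmodule_isLmodule.Build R coinduced scaleA scale1 scaleDr scaleDl.

Lemma coinducedZ a (f : coinduced) r : val (a *: f) r = val f (r * a).
Proof. by []. Qed.

End Coinduction.

Section EnoughInjectives.

(** By Euclidean division a nonzero ideal of the integers is generated by its least positive element
    [n]; dividing the value at [n] by [n] gives the multiplier. *)
Lemma divisible_baer (D : lmodType int) :
  (forall (n : int) (d : D), n != 0 -> exists e, n *: e = d) -> baer D.
Proof.
move=> div G G0 G_lin G_fun.
have [[n [x [n_gt0 Gx]]]|none] :=
  pselect (exists n : nat, exists x, (0 < n)%N /\ G n x); last first.
  exists 0 => r x Gx; rewrite scaler0.
  suff r0 : r = 0 by apply: G_fun; rewrite -r0.
  have GN : G (- r) (- x).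
    by have := G_lin (-1) _ _ _ _ Gx G0; rewrite mulN1r scaleN1r !addr0.
  case: (intP r) Gx GN => // n Gx GN; exfalso; apply: none.
    by exists n.+1, x.
  by exists n.+1, (- x); rewrite opprK in GN.
have ex : exists n : nat, `[< (0 < n)%N /\ exists x, G n x >].
  by exists n; apply/asboolP; split=> //; exists x.
have [{x Gx n_gt0}n /asboolP[n_gt0 [x Gx]] minn] := ex_minnP ex.
have [|e eE] := div n x; first by rewrite eqz_nat -lt0n.
exists e => r y Gy.
have Gr : G (r %% n)%Z (y - (r %/ n)%Z *: x).
  have := G_lin (- (r %/ n)%Z) _ _ _ _ Gx Gy.
  by rewrite {2}(divz_eq r n) mulNr addKr scaleNr addrC.
have r_lt : (r %% n < n)%Z by rewrite ltz_pmod.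
have r_ge : (0 <= r %% n)%Z by rewrite modz_ge0 // eqz_nat -lt0n.
have r0 : (r %% n)%Z = 0.
  move: r_ge r_lt Gr; case: (r %% n)%Z => // k _ k_lt Gk.
  have [->//|k_gt0] := posnP k.
  have := minn k (asboolT (conj k_gt0 (ex_intro _ _ Gk))).
  by rewrite leqNgt (_ : k < n)%N.
rewrite r0 in Gr; have /eqP := G_fun _ Gr; rewrite subr_eq0 => /eqP->.
by rewrite -eE scalerA {2}(divz_eq r n) r0 addr0.
Qed.

(* With F free on the elements of M, the group (Q (x) F)/(relations of M) is
   divisible and contains M = F/(relations of M). *)
Lemma divisible_hull (M : zmodType) :
  exists (D : lmodType int) (f : {additive M -> D}),
    injective f /\ injective_module D.
Proof.
have [j [jE j_sum]] :=
  @exists_free_map int M (zmodule {freeg M / rat}) (fun x => << x >>).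
have [s [sE _]] := @exists_free_map int M (zmodule M) (fun x => x).
(* [j] only casts integer coefficients to rationals, hence it is injective. *)
have coeff_j m y : coeff y (j m : {freeg M / rat}) = (coeff y m)%:~R.
  rewrite j_sum -[in RHS](freeg_sumE m) raddf_sum [in RHS]raddf_sum /= (raddf_sum (intmul 1)).
  apply: eq_bigr => x _.
  rewrite scalezrE raddfMz /= !coeffU mul1r.
  by case: eqP => _; rewrite ?mulr1 // mulr0 mul0rz.
have inj_j : injective j.
  move=> m m' E; apply/eqP/freeg_eqP => y; apply: (@intr_inj rat).
  by rewrite -!coeff_j E.
have [D [p [surj_p kerp]]] :=
  quotient_exists (image_submodule j (ker_submodule s (zero_submodule (zmodule M)))).
have add : GRing.zmod_morphism (fun x : M => p << x >>).
  move=> x y; rewrite -linearB; apply/eqP; rewrite -subr_eq0 -linearB; apply/eqP/kerp.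
  exists (<< x - y >> - (<< x >> - << y >>)); last by rewrite !linearB /= !jE.
  by rewrite !linearB /= !sE -opprD; exact: subrr.
pose L := GRing.isZmodMorphism.Build _ _ _ add.
pose f : {additive M -> D} := HB.pack (fun x : M => p << x >>) L.
exists D, f; split.
  apply: raddf_inj => x /kerp[m sm0 jm].
  have mx : m = << x >> by apply: inj_j; rewrite jE.
  by rewrite -sm0 mx sE.
apply/baer_injective/divisible_baer => n d n0.
have [y <-] := surj_p d.
exists (p ((n%:~R)^-1 *: (y : {freeg M / rat}))); rewrite -linearZ; congr (p _).
rewrite scalezrE -scaler_int scalerA divff ?scale1r //.
by rewrite intr_eq0.
Qed.

Variable R : comNzRingType.
Implicit Types A B C E : lmodType R.

Let additive_zlinear A (D : lmodType int) (f : A -> D) :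
  GRing.zmod_morphism f ->
  exists g : {linear zmodule A -> D}, forall x, g x = f x.
Proof.
move=> add; apply: exists_linear => a x y.
pose L := GRing.isZmodMorphism.Build A D f add.
pose F : {additive A -> D} := HB.pack f L.
rewrite scalezrE [LHS](raddfD F); congr (_ + _).
by rewrite [LHS](raddfMz F) -scaler_int intz.
Qed.

(** By adjunction, a linear map into Hom_Z(R, D) amounts to the additive map obtained by evaluation
    at 1. That one extends over the integers to [h], and [b] is sent to the function r -> h(r b). *)
Lemma coinduced_injective (D : lmodType int) :
  injective_module D -> injective_module (coinduced R D).
Proof.
move=> injD A B g f inj_g.
have [|f1 f1E] := @additive_zlinear A D (fun a => val (f a) 1).
  by move=> x y; rewrite linearB.
have [|g1 g1E] := @additive_zlinear A (zmodule B) (fun a => g a).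
  by move=> x y; rewrite linearB.
have [|h hE] := injD _ _ g1 f1.
  by move=> x y; rewrite !g1E; exact: inj_g.
have add b : GRing.zmod_morphism (fun r : R => h (r *: b : B)).
  by move=> r s; rewrite scalerBl -linearB.
have lin : linear (fun b => Coinduced (add b)).
  move=> a x y; apply/val_inj/funext => r /=.
  by rewrite scalerDr scalerA; exact: (raddfD h).
have [k kE] := exists_linear lin.
exists k => a; rewrite kE; apply/val_inj/funext => r /=.
by rewrite -linearZ -g1E hE f1E linearZ coinducedZ mul1r.
Qed.

Lemma enough_injectives A :
  exists E (i : {linear A -> E}), injective_module E /\ injective i.
Proof.
have [D [f [inj_f injD]]] := divisible_hull A.
have add a : GRing.zmod_morphism (fun r : R => f (r *: a)).
  by move=> r s; rewrite scalerBl -raddfB.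
have lin : linear (fun a => Coinduced (add a)).
  move=> a x y; apply/val_inj/funext => r /=.
  by rewrite scalerDr scalerA; exact: (raddfD f).
have [k kE] := exists_linear lin.
exists (coinduced R D), k; split; first exact: coinduced_injective.
move=> x y; rewrite !kE => /(congr1 (fun u => val u 1)) /=.
by rewrite !scale1r; exact: inj_f.
Qed.

Lemma enough_cosyzygies A : exists C, cosyzygy A C.
Proof.
have [E [i [injE inj_i]]] := enough_injectives A.
have [C [p [surj_p kerp]]] := quotient_exists (image_submodule i (full_submodule A)).
exists C, E, i, p; split=> // e; rewrite kerp.
by split=> [[b _ <-]|[b <-]]; exists b.
Qed.

End EnoughInjectives.

(** * Flatness of projective modules *)

Section Flat.
Variable R : comNzRingType.
Implicit Types A B F P : lmodType R.

(** Well-definedness of the contraction of F tensor A to A by [phi]; it detects the coefficients of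
    the normal form used for projective modules. *)
Lemma tensor_eq_pairing F A (phi : {linear F -> R^o}) (s t : seq (F * A)) :
  tensor_eq s t ->
  \sum_(p <- s) phi p.1 *: p.2 = \sum_(p <- t) phi p.1 *: p.2.
Proof.
elim=> {s t} //.
- by move=> s t u _ -> _ ->.
- by move=> s s' t t' _ es _ et; rewrite !big_cat es et.
- by move=> s t; rewrite !big_cat /= addrC.
- by move=> x y a; rewrite !big_cons !big_nil !addr0 /= linearD scalerDl.
- by move=> x a b; rewrite !big_cons !big_nil !addr0 /= scalerDr.
- by move=> r x a; rewrite !big_cons !big_nil !addr0 /= linearZ scalerA mulrC.
- by rewrite big_cons !big_nil addr0 scaler0.
Qed.

Lemma tensor_eq0l F A (a : A) : tensor_eq [:: (0 : F, a)] [::].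
Proof.
apply: tensor_trans (tensor_zero F A).
by have := tensor_scale 0 (0 : F) a; rewrite !scale0r.
Qed.

Lemma tensor_eq_sumr F A (D : seq F) (c : F -> R) (a : A) :
  tensor_eq [:: (\sum_(x <- D) c x *: x, a)] [seq (x, c x *: a) | x <- D].
Proof.
elim: D => [|x D IH]; first by rewrite big_nil; exact: tensor_eq0l.
rewrite big_cons; apply: tensor_trans (tensor_addl _ _ _) _.
exact: (tensor_cat (tensor_scale (c x) x a) IH).
Qed.

Lemma tensor_eq_merge F A (D : seq F) (f g : F -> A) :
  tensor_eq ([seq (x, f x) | x <- D] ++ [seq (x, g x) | x <- D])
            [seq (x, f x + g x) | x <- D].
Proof.
elim: D => [|x D IH] /=; first exact: tensor_refl.
set s := map _ _ in IH *; set t := map _ _ in IH *.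
apply: tensor_trans (tensor_cat (tensor_sym (tensor_addr x (f x) (g x))) IH).
have := tensor_cat (tensor_comm s [:: (x, g x)]) (tensor_refl t).
by rewrite -catA => h; exact: (tensor_cat (tensor_refl [:: (x, f x)]) h).
Qed.

(* The dual basis e_x, c_x of a projective module P puts every tensor in the
   normal form sum_x e_x (x) (sum_p c_x(p.1) p.2), and the coefficients of
   this form only depend on the class of the tensor. *)
Lemma projective_flat P : projective P -> flat P.
Proof.
move=> projP A B f inj_f s t.
have [p [p1 pE]] := @exists_free_map R P P id.
have [|sg sgE] := projP _ _ p idfun.
  by move=> x; exists << x >>; exact: p1.
have lin_c x : linear (fun y => coeff x (sg y) : R^o).
  by move=> a y z; rewrite linearP raddfD /=; congr (_ + _); rewrite coeff_fgscale.
have [c cE] := choice (fun x => exists_linear (lin_c x)).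
(* One finite list that carries the dual-basis expansions of all first components of [s] and [t], so
   that both normal forms have the same index list. *)
pose D := undup (flatten [seq dom (sg y.1) | y <- s ++ map (fun p => (p.1, 0 : A)) t]).
have DE (y : P) a : (y, a) \in s ++ map (fun p => (p.1, 0 : A)) t ->
    \sum_(x <- D) c x y *: x = y.
  move=> ys; rewrite -[RHS](sgE y) pE.
  rewrite (bigID (fun x => x \in dom (sg y))) /= [X in _ + X]big1 ?addr0.
    rewrite -big_filter; under eq_bigr do rewrite cE.
    apply: perm_big; apply: uniq_perm.
    - by rewrite filter_uniq // undup_uniq.
    - exact: uniq_dom.
    - move=> x; rewrite mem_filter; case: (boolP (x \in dom _)) => //= xd.
      rewrite mem_undup; apply/flattenP; exists (dom (sg y)) => //.
      by apply/mapP; exists (y, a).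
  by move=> x; rewrite mem_dom negbK cE => /eqP->; rewrite scale0r.
have normal (u : seq (P * A)) :
    {in u, forall p, \sum_(x <- D) c x p.1 *: x = p.1} ->
    tensor_eq u [seq (x, \sum_(p <- u) c x p.1 *: p.2) | x <- D].
  elim: u => [|q u IH] uD.
    elim: (D) => [|x D' IHD] /=; first exact: tensor_refl.
    have x0 : tensor_eq [::] [:: (x, 0 : A)].
      apply/tensor_sym/(tensor_trans _ (tensor_zero P A)).
      by have := tensor_scale 0 x (0 : A); rewrite !scale0r => /tensor_sym.
    by rewrite big_nil; exact: (tensor_cat x0 IHD).
  rewrite -cat1s; under eq_map do rewrite big_cons.
  apply: tensor_trans (tensor_eq_merge D (fun x => c x q.1 *: q.2) _).
  apply: tensor_cat; last by apply: IH => v vu; apply: uD; rewrite inE vu orbT.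
  case: q uD => y a uD /=; have /= yE := uD (y, a) (mem_head _ _); rewrite -{1}yE.
  exact: tensor_eq_sumr.
move=> eqst.
apply: (tensor_trans (normal s _)).
  by case=> y a ys; apply: (DE y a); rewrite mem_cat ys.
suff -> : [seq (x, \sum_(p <- s) c x p.1 *: p.2) | x <- D] =
          [seq (x, \sum_(p <- t) c x p.1 *: p.2) | x <- D].
  apply/tensor_sym/normal; case=> y a yt; apply: (DE y 0).
  by rewrite mem_cat; apply/orP; right; apply/mapP; exists (y, a).
apply: eq_map => x; congr pair; apply: inj_f.
have := tensor_eq_pairing (c x) eqst.
rewrite !big_map !linear_sum /= => E.
under eq_bigr do rewrite linearZ; under [RHS]eq_bigr do rewrite linearZ.
exact: E.
Qed.

End Flat.

(** * The principal ideal theorem and regular sequences *)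

Section Ideals.
Variable R : comNzRingType.
Implicit Types I J K L N T p q : R -> Prop.

Definition ideal I := @is_submodule R R^o I.

Definition fg_ideal I := exists s : seq R,
  forall x, I x <-> exists c : nat -> R, x = \sum_(i < size s) c i * s`_i.

Hypothesis noethR : noetherian R.

Lemma ideal_mul I a x : ideal I -> I x -> I (a * x).
Proof. by move=> idI; exact: (submodZ idI). Qed.

Lemma ideal_mulr I a x : ideal I -> I x -> I (x * a).
Proof. by rewrite mulrC; exact: ideal_mul. Qed.

Lemma ideal1 I x : ideal I -> I 1 -> I x.
Proof. by move=> idI I1; rewrite -[x]mulr1; exact: ideal_mul. Qed.

Lemma idealrP I : ideal I -> ~ I 1 -> idealr_closed (fun x => `[< I x >]).
Proof.
move=> idI nI1; split; first by apply/asboolP; exact: submod0 idI.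
  by apply/negP => /asboolP.
by move=> a x y /asboolP Ix /asboolP Iy; apply/asboolP; exact: idI.2.
Qed.

Lemma idealrW (I : {pred R}) :
  idealr_closed I -> ideal (fun x => x \in I) /\ 1 \notin I.
Proof. by case=> I0 I1 IP; do ![split=> //]. Qed.

Lemma ideal_fg I : ideal I -> fg_ideal I.
Proof.
move=> idI; have [I1|nI1] := pselect (I 1).
  exists [:: 1] => x; split=> _; last exact: ideal1.
  by exists (fun _ => x); rewrite big_ord1 mulr1.
have [s sP] := noethR (idealrP idI nI1); exists s => x; rewrite -sP.
by split=> [Ix|/asboolP]; [exact/asboolP|].
Qed.

(** The union of a chain of ideals is finitely generated, so one member contains all generators and
    equals the union. Zorn's lemma then applies to an arbitrary [P]. *)
Lemma noetherian_max (P : (R -> Prop) -> Prop) I0 :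
  ideal I0 -> P I0 ->
  exists I, [/\ ideal I, P I &
    forall J, ideal J -> P J -> (forall x, I x -> J x) -> forall x, J x -> I x].
Proof.
move=> idI0 PI0.
have [|X [PX maxX]] := @Zorn_bigcup R (fun X => X = set0 \/ ideal X /\ P X).
  move=> F FP totF.
  have [[X0 [FX0 [x0 X0x0]]]|none] := pselect (exists X, F X /\ exists x, X x);
      last first.
    left; rewrite predeqE => x; split=> // -[X FX Xx].
    by apply: none; exists X; split=> //; exists x.
  have gr (X : set R) x : F X -> X x -> ideal X /\ P X.
    by move=> FX Xx; have [E|//] := FP X FX; rewrite E in Xx.
  pose U := (\bigcup_(X in F) X)%classic.
  have idU : ideal U.
    split; first by exists X0 => //; have [/submod0] := gr _ _ FX0 X0x0.
    move=> a x y [X FX Xx] [Y FY Yy].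
    have [XY|YX] := totF X Y FX FY.
      by exists Y => //; have [[_ h] _] := gr _ _ FY Yy; apply: h => //; exact: XY.
    by exists X => //; have [[_ h] _] := gr _ _ FX Xx; apply: h => //; exact: YX.
  have [s sP] := ideal_fg idU.
  have Us i : (i < size s)%N -> U s`_i.
    move=> lt_i; apply/sP; exists (fun j => (j == i)%:R).
    rewrite (bigD1 (Ordinal lt_i)) //= eqxx mul1r big1 ?addr0 // => j ne.
    by rewrite -(inj_eq val_inj) /= in ne; rewrite (negPf ne) mul0r.
  have [Y [FY [y Yy] Ys]] : exists Y, [/\ F Y, exists y, Y y &
      forall i, (i < size s)%N -> Y s`_i].
    suff : forall n, (n <= size s)%N -> exists Y, [/\ F Y, exists y, Y y &
      forall i, (i < n)%N -> Y s`_i] by apply.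
    elim=> [|n IH] ltn; first by exists X0; split=> //; exists x0.
    have [Y [FY [y Yy] Ys]] := IH (ltnW ltn).
    have [Z FZ Zs] := Us n ltn.
    have [YZ|ZY] := totF Y Z FY FZ.
      exists Z; split=> //; first by exists s`_n.
      by move=> i; rewrite ltnS leq_eqVlt => /orP[/eqP->//|/Ys/YZ].
    exists Y; split=> //; first by exists y.
    by move=> i; rewrite ltnS leq_eqVlt => /orP[/eqP->|/Ys//]; exact: ZY.
  have [idY PY] := gr _ _ FY Yy; right.
  suff UY : U = Y by rewrite -/U UY.
  rewrite predeqE => x; split=> [/sP[c ->]|Yx]; last by exists Y.
  by apply: (submod_sum idY) => i _; apply: ideal_mul => //; exact: Ys.
have [E|[idX PX']] := PX.
  exfalso; apply: (maxX I0); last by right.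
  by rewrite E; split=> // h; exact: h (submod0 idI0).
exists X; split=> // J idJ PJ XJ; apply: contrapT => nJX.
by apply: (maxX J); [split|right].
Qed.

Definition idealD I J : R -> Prop := fun x => exists2 y, I y & exists2 z, J z & x = y + z.
Definition principal (a : R) : R -> Prop := fun x => exists c, x = c * a.

Lemma ideal_idealD I J : ideal I -> ideal J -> ideal (idealD I J).
Proof.
move=> idI idJ; split.
  exists 0; first exact: submod0 idI.
  by exists 0; [exact: submod0 idJ|rewrite addr0].
move=> a _ _ [x Ix [y Jy ->]] [x' Ix' [y' Jy' ->]].
exists (a *: (x : R^o) + x'); first exact: idI.2.
exists (a *: (y : R^o) + y'); first exact: idJ.2.
by rewrite scalerDr addrACA.
Qed.

Lemma ideal_principal a : ideal (principal a).
Proof.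
split; first by exists 0; rewrite mul0r.
by move=> c _ _ [x ->] [y ->]; exists (c * x + y); rewrite mulrDl -mulrA.
Qed.

Lemma principal_id a : principal a a. Proof. by exists 1; rewrite mul1r. Qed.

Lemma idealDl I J x : ideal J -> I x -> idealD I J x.
Proof.
by move=> idJ Ix; exists x => //; exists 0; [exact: submod0 idJ|rewrite addr0].
Qed.

Lemma idealDr I J x : ideal I -> J x -> idealD I J x.
Proof.
by move=> idI Jx; exists 0; [exact: submod0 idI|exists x => //; rewrite add0r].
Qed.

Lemma idealD_sub I J K : ideal K -> (forall x, I x -> K x) ->
  (forall x, J x -> K x) -> forall x, idealD I J x -> K x.
Proof.
move=> idK IK JK _ [y Iy [z Jz ->]].
by apply: (submodD idK); [exact: IK|exact: JK].
Qed.

Lemma principal_sub a K : ideal K -> K a -> forall x, principal a x -> K x.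
Proof. by move=> idK Ka _ [c ->]; exact: ideal_mul. Qed.

Definition is_prime p :=
  [/\ ideal p, ~ p 1 & forall x y, p (x * y) -> p x \/ p y].

(* The contraction to R of the extension of I to the localization at p. *)
Definition sat p I : R -> Prop := fun x => exists2 u, ~ p u & I (u * x).

Section Saturation.
Variable p : R -> Prop.
Hypothesis prime_p : is_prime p.

Lemma prime_ideal_p : ideal p. Proof. by case: prime_p. Qed.

Lemma notin_primeM u v : ~ p u -> ~ p v -> ~ p (u * v).
Proof. by move=> nu nv puv; case: prime_p => _ _ /(_ _ _ puv)[]. Qed.

Lemma ideal_sat I : ideal I -> ideal (sat p I).
Proof.
move=> idI; have [idp p1 _] := prime_p; split.
  by exists 1; rewrite ?mulr0 //; exact: submod0 idI.
move=> a x y [u nu Iux] [v nv Ivy]; exists (u * v); first exact: notin_primeM.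
rewrite mulrDr; apply: (submodD idI).
  rewrite (_ : _ * _ = a * v * (u * x)); first exact: ideal_mul.
  by rewrite /GRing.scale /=; ring.
by rewrite -mulrA; exact: ideal_mul.
Qed.

Lemma sub_sat I x : I x -> sat p I x.
Proof. by move=> Ix; exists 1; [case: prime_p|rewrite mul1r]. Qed.

Lemma sat_sat I x : sat p (sat p I) x -> sat p I x.
Proof.
move=> [u nu [v nv Ivux]]; exists (v * u); first exact: notin_primeM.
by rewrite -mulrA.
Qed.

Lemma sat_mono I J : (forall x, I x -> J x) -> forall x, sat p I x -> sat p J x.
Proof. by move=> IJ x [u nu Iux]; exists u => //; exact: IJ. Qed.

(* Nakayama's lemma over the localization at p. *)
Lemma nakayama N L K : ideal N -> ideal L -> (forall x, K x -> p x) ->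
  (forall T, ideal T -> (forall x, L x -> T x) ->
     (forall x y, K x -> N y -> T (x * y)) -> forall x, N x -> sat p T x) ->
  forall x, N x -> sat p L x.
Proof.
move=> idN idL Kp hN; apply: contrapT => bad.
(* [T] is a largest saturated ideal over [L] that does not contain [N]; by [hN] it is enough to show
   that all products of [K] and [N] lie in [T]. *)
have [T [idT [LT satT nNT] maxT]] := @noetherian_max
  (fun T => [/\ forall x, L x -> T x, forall x, sat p T x -> T x &
     ~ forall x, N x -> T x]) _ (ideal_sat idL)
  (And3 (@sub_sat L) (@sat_sat L) bad).
apply: nNT => x Nx; apply: (satT); apply: hN Nx => // k z Kk Nz.
apply: contrapT => nT.
pose T' := sat p (idealD T (principal (k * z))).
have idT' : ideal T' by apply/ideal_sat/ideal_idealD/ideal_principal.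
have T'kz : T' (k * z).
  by apply/sub_sat/idealDr => //; exact: principal_id.
have TT' y : T y -> T' y.
  by move=> Ty; apply/sub_sat/idealDl => //; exact: ideal_principal.
have NT' : forall x, N x -> T' x.
  apply: contrapT => nNT'; apply: nT; apply: (maxT T') => //.
  by split=> //; [move=> y Ly; exact/TT'/LT|exact: sat_sat].
have [u nu [t Tt [_ [c ->] uz]]] := NT' z Nz.
(* The factor [u - c * k] sends [z] into [T] and lies outside [p] because [k] is in [p]; saturation
   puts [z] in [T]. *)
apply: nT; apply: ideal_mul => //; apply: satT; exists (u - c * k).
  move=> h; apply: nu; rewrite -(subrK (c * k) u).
  by apply: (submodD prime_ideal_p) => //; apply/(ideal_mul _ prime_ideal_p)/Kp.
by rewrite mulrBl uz mulrA addrK.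
Qed.

(* Associated primes: a maximal conductor (I : y) with y outside I is prime. *)
Lemma exists_conductor I q : ideal I -> (forall x, sat p I x -> I x) -> ~ I 1 ->
  ideal q -> (forall x, q x -> I x) ->
  (forall q', is_prime q' -> (forall x, q x -> q' x) ->
     (forall x, q' x -> p x) -> forall x, p x -> q' x) ->
  exists2 y, ~ I y & forall x, p x -> I (x * y).
Proof.
move=> idI satI nI1 idq qI minp.
have id_cond y : ideal (fun x => I (x * y)).
  split; first by rewrite mul0r; exact: submod0 idI.
  move=> a x z Ix Iz; rewrite mulrDl; apply: (submodD idI) => //.
  by rewrite -mulrA; exact: ideal_mul.
have base : exists2 y, ~ I y & forall x, I (x * 1) <-> I (x * y) by exists 1.
have [C [idC [y nIy CE] maxC]] := @noetherian_max
  (fun C => exists2 y, ~ I y & forall x, C x <-> I (x * y)) _ (id_cond 1) base.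
exists y => // x px; apply/CE; apply: minp => //.
- split=> //; first by move/CE; rewrite mul1r.
  move=> a b /CE Iaby; have [Iby|nIby] := pselect (I (b * y)); first by right; apply/CE.
  left; apply: (maxC (fun x => I (x * (b * y)))) => //.
  - by exists (b * y).
  - by move=> z /CE Izy; rewrite mulrCA; exact: ideal_mul.
  - by rewrite mulrA.
- by move=> z qz; apply/CE; exact: ideal_mulr idI (qI _ qz).
- move=> z /CE Izy; apply: contrapT => npz; apply: nIy; apply: satI.
  by exists z.
Qed.

End Saturation.

End Ideals.

(** * Krull's principal ideal theorem by symbolic powers *)

Section PrincipalIdealTheorem.
Variable R : comNzRingType.
Hypothesis noethR : noetherian R.
Implicit Types I J K N T p q : R -> Prop.

(** The product ideal, given impredicatively to match the quantification over [T] in [nakayama]. *)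
Definition idealM I J : R -> Prop := fun x =>
  forall T, ideal T -> (forall a b, I a -> J b -> T (a * b)) -> T x.

Lemma ideal_idealM I J : ideal (idealM I J).
Proof.
split=> [T idT _|a x y Ix Iy T idT h]; first exact: submod0 idT.
by apply: idT.2; [exact: Ix|exact: Iy].
Qed.

Lemma idealM_sub I J J' :
  (forall x, J x -> J' x) -> forall x, idealM I J x -> idealM I J' x.
Proof. by move=> JJ' x h T idT hT; apply: h => // a b Ia /JJ'; exact: hT. Qed.

Lemma idealD_mono I I' J x :
  (forall y, I y -> I' y) -> idealD I J x -> idealD I' J x.
Proof. by move=> II' [y Iy [z Jz ->]]; exists y; [exact: II'|exists z]. Qed.

(* The quotient of the localization at p by q is Artinian when p is minimal
   over q. *)
Lemma descending_stabilizes p q (J : nat -> R -> Prop) I :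
  is_prime p -> ideal q ->
  (forall q', is_prime q' -> (forall x, q x -> q' x) ->
     (forall x, q' x -> p x) -> forall x, p x -> q' x) ->
  (forall n, ideal (J n)) -> (forall n x, J n.+1 x -> J n x) ->
  ideal I -> (forall x, sat p I x -> I x) -> (forall x, q x -> I x) ->
  exists n, forall n', (n <= n')%N -> forall x, J n x -> sat p (idealD (J n') I) x.
Proof.
move=> prime_p idq minp idJ decJ idI0 satI0 qI0; apply: contrapT => bad0.
have decJ' m n : (m <= n)%N -> forall x, J n x -> J m x.
  by move=> /subnK<-; elim: (n - m)%N => // k IH x; rewrite addSn => /decJ/IH.
(* Noetherian induction: [I] is maximal among the saturated ideals over [q] modulo which the
   sequence fails to stabilize. *)
have {I idI0 satI0 qI0 bad0}[I [idI [satI qI bad] maxI]] := @noetherian_max _ noethR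
  (fun I => [/\ forall x, sat p I x -> I x, forall x, q x -> I x &
     ~ exists n, forall n', (n <= n')%N -> forall x, J n x ->
        sat p (idealD (J n') I) x]) I idI0 (And3 satI0 qI0 bad0).
have idJI n : ideal (idealD (J n) I) by exact: ideal_idealD.
have nI1 : ~ I 1.
  move=> I1; apply: bad; exists 0%N => n _ x _; apply: sub_sat => //.
  by apply: idealDr => //; exact: ideal1.
(* Locally at [p], adjoining [y] to [I] adds a module of length one, and modulo the larger ideal
   [I'] the sequence does stabilize. *)
have [y nIy pyI] := exists_conductor noethR idI satI nI1 idq qI minp.
pose I' := sat p (idealD I (principal y)).
have idI' : ideal I' by apply/ideal_sat => //; exact/ideal_idealD/ideal_principal.
have I'y : I' y by apply/sub_sat/idealDr => //; exact: principal_id.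
have II' x : I x -> I' x.
  by move=> Ix; apply/sub_sat/idealDl => //; exact: ideal_principal.
have [n0 n0P] : exists n, forall n', (n <= n')%N -> forall x, J n x ->
    sat p (idealD (J n') I') x.
  apply: contrapT => bad'; apply: nIy; apply: (maxI I') => //.
  by split=> //; [exact: sat_sat|move=> x /qI/II'].
(* If [y] is locally in every [J n] + [I], stability modulo [I'] gives stability modulo [I].
   Otherwise, beyond [n1], the coefficient [c] of [y] must lie in [p], so [c * y] is in [I]. *)
have [in_y|/existsNP[n1 n1P]] := pselect (forall n, sat p (idealD (J n) I) y).
  apply: bad; exists n0 => n le_n x /(n0P n le_n) h.
  apply: sat_sat => //; apply: sat_mono h; apply: idealD_sub.
  - exact: ideal_sat.
  - by move=> z Jz; apply/sub_sat/idealDl.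
  - move=> z I'z; apply: sat_sat => //; apply: sat_mono I'z.
    apply: idealD_sub; first exact: ideal_sat.
      by move=> t It; apply/sub_sat/idealDr.
    by apply: principal_sub => //; exact: ideal_sat.
apply: bad; exists (maxn n0 n1) => n; rewrite geq_max => /andP[le0 le1] x Jx.
have [u nu [j Jj [i' [v nv [i Ii [_ [c ->] vi']]] ux]]] :=
  n0P n le0 x (decJ' _ _ (leq_maxl n0 n1) _ Jx).
exists (v * u); first exact: notin_primeM.
exists (v * j); first exact: ideal_mul.
exists (i + c * y); last by rewrite -mulrA ux mulrDr vi'.
apply: (submodD idI) => //; apply: pyI; apply: contrapT => nc.
apply: n1P; exists c => //.
rewrite (_ : c * y = (v * u * x - v * j) - i); last first.
  by rewrite -mulrA ux mulrDr vi'; ring.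
exists (v * u * x - v * j); last by exists (- i) => //; exact: submodN idI _ Ii.
apply: (submodB (idJ n1)).
  by apply: ideal_mul => //; apply: decJ' Jx; exact: leq_maxr.
by apply: ideal_mul => //; apply: decJ' Jj.
Qed.

(* Krull: no prime q1 fits strictly between q0 and a prime p minimal over
   q0 + (x).  The symbolic powers J n of q1 modulo q0 stabilize modulo x, and
   two applications of Nakayama's lemma put some J n inside q0. *)
Lemma krull_principal q0 q1 p x :
  is_prime q0 -> is_prime q1 -> is_prime p ->
  (forall y, q0 y -> q1 y) -> ~ (forall y, q1 y -> q0 y) ->
  (forall y, q1 y -> p y) -> p x -> ~ q1 x ->
  exists q, [/\ is_prime q, forall y, q0 y -> q y, q x,
    forall y, q y -> p y & ~ forall y, p y -> q y].
Proof.
move=> prime0 prime1 primep q01 nq10 q1p px nq1x; apply: contrapT => none.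
have [id0 _ _] := prime0; have [id1 _ _] := prime1; have [idp _ _] := primep.
pose q := idealD q0 (principal x).
have idq : ideal q by exact/ideal_idealD/ideal_principal.
have minp q' : is_prime q' -> (forall y, q y -> q' y) ->
    (forall y, q' y -> p y) -> forall y, p y -> q' y.
  move=> prime' qq' q'p; apply: contrapT => npq'; apply: none; exists q'; split=> //.
    by move=> y q0y; apply/qq'/idealDl => //; exact: ideal_principal.
  by apply/qq'/idealDr => //; exact: principal_id.
pose J := fix J n := match n with
  | 0 => fun _ : R => True
  | n'.+1 => sat q1 (idealD (idealM q1 (J n')) q0)
  end.
have idJ n : ideal (J n).
  case: n => [|n]; first by split.
  by apply: ideal_sat => //; apply: ideal_idealD => //; exact: ideal_idealM.
have decJ n y : J n.+1 y -> J n y.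
  elim: n y => [//|n IH] y; apply: sat_mono => z.
  by apply: idealD_mono => t; exact: idealM_sub.
have satJ n y : sat q1 (J n) y -> J n y by case: n => // n; exact: sat_sat.
have q0J n y : q0 y -> J n y.
  case: n => // n q0y; apply: sub_sat => //; apply: idealDr => //; exact: ideal_idealM.
have [n nP] := descending_stabilizes (I := sat p q) primep idq minp idJ decJ
  (ideal_sat primep idq) (@sat_sat _ _ primep q) (@sub_sat _ _ primep q).
(* Nakayama at [p] with the ideal (x): the term [b * x] of [vuz] lies in [J n], and [b] does too
   because [x] is outside [q1] and [J n] is saturated at [q1]. *)
have JJ1 y : J n y -> J n.+1 y.
  move=> Jy; apply: (satJ n.+1).
  suff [u nu Juy] : sat p (J n.+1) y by exists u => // /q1p.
  apply: (nakayama noethR primep (N := J n) (K := principal x)) Jy => //.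
    exact: principal_sub.
  move=> T idT JT xJT z Jz.
  have [u nu [j Jj [i [v nv [a q0a [_ [b ->] vi]]] uz]]] := nP n.+1 (leqnSn n) z Jz.
  have vuz : v * u * z = v * j + a + b * x by rewrite -mulrA uz mulrDr vi addrA.
  exists (v * u); first exact: notin_primeM.
  rewrite vuz; apply: (submodD idT).
    by apply/JT/(submodD (idJ _)); [exact: ideal_mul|exact: q0J].
  rewrite mulrC; apply: xJT; first exact: principal_id.
  apply: satJ; exists x => //; rewrite mulrC.
  rewrite (_ : b * x = v * u * z - (v * j + a)); last by rewrite vuz; ring.
  apply: (submodB (idJ n)); first exact: ideal_mul (idJ n) Jz.
  by apply: (submodD (idJ n)); [apply/decJ/(ideal_mul _ (idJ n.+1))|exact: q0J].
(* Nakayama at [q1]: since [J n] lies in [J n.+1], it lies in the saturation of q1 J_n + q0. *)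
have Jq0 y : J n y -> q0 y.
  move=> Jy; suff : sat q1 q0 y.
    by case=> u nu q0uy; case: prime0 => _ _ /(_ _ _ q0uy)[/q01|].
  apply: (nakayama noethR prime1 (N := J n) (K := q1)) Jy => // T idT q0T qJT z.
  move/JJ1; apply: sat_mono; apply: idealD_sub => // t h.
  exact: h idT qJT.
(* The power [y ^+ n] lies in [J n], hence in the prime [q0]. *)
apply: nq10 => y q1y.
have : q0 (y ^+ n).
  apply: Jq0; elim: (n) => // k IH; apply: sub_sat => //; apply: idealDl => //.
  by rewrite exprS => T _ h; exact: h.
elim: (n) => [|k IH]; first by rewrite expr0; case: prime0.
by rewrite exprS; case: prime0 => _ _ h /h[].
Qed.

End PrincipalIdealTheorem.

(** * Chains of primes when one element is adjoined *)

Section PrimeChains.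
Variable R : comNzRingType.
Implicit Types I J p q : R -> Prop.

(* A chain of n.+1 primes with top p, all containing I. *)
Fixpoint chain_above I n p : Prop := is_prime p /\
  match n with
  | 0 => forall x, I x -> p x
  | n'.+1 => exists q, [/\ forall x, q x -> p x, ~ (forall x, p x -> q x) &
      chain_above I n' q]
  end.

Lemma chain_above_prime I n p : chain_above I n p -> is_prime p.
Proof. by case: n => [|n] []. Qed.

Lemma chain_above_mono I J n p : (forall x, I x -> J x) ->
  chain_above J n p -> chain_above I n p.
Proof.
move=> IJ; elim: n p => [|n IH] p [prp h]; split=> //; first by move=> x /IJ/h.
by have [q [qp npq /IH hq]] := h; exists q.
Qed.

Lemma chain_above_sub I n p : chain_above I n p -> forall x, I x -> p x.
Proof. by elim: n p => [|n IH] p [_ //] [q [qp _ /IH Iq]] x /Iq/qp. Qed.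

Lemma chain_above_top I n p q : is_prime q -> (forall x, p x -> q x) ->
  chain_above I n p -> chain_above I n q.
Proof.
move=> prq pq; case: n => [|n] [prp h]; split=> //; first by move=> x /h/pq.
have [r [rp npr hr]] := h; exists r; split=> //; first by move=> x /rp/pq.
by move=> qr; apply: npr => x /pq/qr.
Qed.

Lemma chain_above_bottom I n p : chain_above I n p ->
  exists q, [/\ is_prime q, forall x, I x -> q x & chain_above q n p].
Proof.
elim: n p => [|n IH] p [prp h]; first by exists p.
have [q [qp npq /IH[r [prr Ir hr]]]] := h.
by exists r; split=> //; split=> //; exists q.
Qed.

Lemma chain_above_extend I n q0 q1 p : is_prime q0 -> (forall x, I x -> q0 x) ->
  (forall x, q0 x -> q1 x) -> ~ (forall x, q1 x -> q0 x) ->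
  chain_above q1 n p -> chain_above I n.+1 p.
Proof.
move=> pr0 Iq0 q01 nq10; elim: n p => [|n IH] p [prp h]; split=> //.
  exists q0; split=> //; first by move=> x /q01/h.
  by move=> pq0; apply: nq10 => x /h/pq0.
by have [q [qp npq /IH hq]] := h; exists q.
Qed.

(** Going down the chain, a link r < q < p with [x] in [p] but not in [q] becomes r < q' < p with
    [x] in [q'], by Krull's theorem. At the bottom the last prime is dropped, which costs one
    step. *)
Lemma chain_above_step I n p x : noetherian R -> ideal I ->
  chain_above I n.+1 p -> p x -> chain_above (idealD I (principal x)) n p.
Proof.
move=> noethR idI; elim: n p => [|n IH] p [prp [q [qp npq hq]]] px.
  split=> //; have [idp _ _] := prp; apply: idealD_sub => //.
    by case: hq => _ h y /h/qp.
  exact: principal_sub.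
split=> //; have [qx|nqx] := pselect (q x).
  by exists q; split=> //; exact: IH.
have [prq [r [rq nqr hr]]] := hq.
have prr := chain_above_prime hr.
have [q' [prq' rq' q'x q'p npq']] := krull_principal noethR prr prq prp rq nqr qp px nqx.
exists q'; split=> //; apply: IH => //; split=> //; exists r; split=> //.
by move=> q'r; apply/nqx/rq/q'r.
Qed.

End PrimeChains.

Section RegularSequence.
Variables (R : comNzRingType) (m : {pred R}) (s : seq R).
Hypothesis noethR : noetherian R.
Hypothesis localR : local_ring m.
Hypothesis gen_m : generates s m.
Implicit Types I p q : R -> Prop.

Let mP x := x \in m.

Lemma local_ideal : ideal mP /\ ~ mP 1.
Proof.
have [[id_m _] _] := localR.
by have [h /negP] := idealrW id_m.
Qed.

Lemma proper_sub_max I : ideal I -> ~ I 1 -> forall x, I x -> x \in m.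
Proof.
move=> idI nI1 x Ix.
have [J [idJ [nJ1 IJ] maxJ]] := @noetherian_max R noethR
  (fun J => ~ J 1 /\ forall x, I x -> J x) I idI (conj nI1 (fun _ => id)).
have [_ uniq_m] := localR.
have /uniq_m <- : maximal_ideal (fun x => `[< J x >]).
  split=> [|K id_K JK]; first exact: idealrP.
  have [idK /negP nK1] := idealrW id_K.
  have JK' y : J y -> y \in K by move=> Jy; apply/JK/asboolP.
  move=> y; apply/idP/asboolP => [|/JK'//].
  by apply: (maxJ (fun y => y \in K)) => //; split=> // z /IJ/JK'.
exact/asboolP/IJ.
Qed.

Lemma local_unit u : u \notin m -> exists v, v * u = 1.
Proof.
move=> num; apply: contrapT => nu.
have : u \in m; last by apply/negP.
apply: (proper_sub_max (ideal_principal u)); last exact: principal_id.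
by case=> v e; apply: nu; exists v.
Qed.

Lemma local_prime : is_prime mP.
Proof.
have [idm nm1] := local_ideal; split=> // x y mxy.
have [mx|/negP/local_unit[v vx]] := pselect (x \in m); [by left|right].
by rewrite -[y]mul1r -vx -mulrA; exact: (ideal_mul v idm mxy).
Qed.

(** Elements outside [m] are units; this turns conclusions of [nakayama] at [m] into statements
    about ideals of R itself. *)
Lemma local_sat I x : ideal I -> sat mP I x -> I x.
Proof.
move=> idI [u /negP/local_unit[v vu] Iux].
by rewrite -[x]mul1r -vu -mulrA; exact: (ideal_mul v idI Iux).
Qed.

Definition initial_ideal j : R -> Prop :=
  fun x => exists c : nat -> R, x = \sum_(i < j) c i * s`_i.

Lemma ideal_initial j : ideal (initial_ideal j).
Proof.
split; first by exists (fun _ => 0); rewrite big1 // => i _; rewrite mul0r.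
move=> a _ _ [c ->] [c' ->]; exists (fun i => a * c i + c' i).
rewrite scaler_sumr -big_split; apply: eq_bigr => i _ /=.
by rewrite mulrDl -mulrA.
Qed.

Lemma initial_idealS j x :
  initial_ideal j.+1 x <-> idealD (initial_ideal j) (principal s`_j) x.
Proof.
split=> [[c ->]|[_ [c ->] [_ [a ->] ->]]].
  rewrite big_ord_recr /=; exists (\sum_(i < j) c i * s`_i); first by exists c.
  by exists (c j * s`_j) => //; exists (c j).
exists (fun i => if (i < j)%N then c i else a).
rewrite big_ord_recr /= ltnn; congr (_ + _).
by apply: eq_bigr => i _; rewrite ltn_ord.
Qed.

Lemma initial_ideal_full x : initial_ideal (size s) x <-> x \in m.
Proof. by rewrite gen_m. Qed.

Lemma mem_generator j : (j < size s)%N -> s`_j \in m.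
Proof.
move=> lt_j; apply/gen_m; exists (fun i => (i == j)%:R).
rewrite (bigD1 (Ordinal lt_j)) //= eqxx mul1r big1 ?addr0 // => i ne.
by rewrite -(inj_eq val_inj) /= in ne; rewrite (negPf ne) mul0r.
Qed.

Lemma chain_initial_step j n : (j < size s)%N ->
  chain_above (initial_ideal j) n.+1 mP -> chain_above (initial_ideal j.+1) n mP.
Proof.
move=> lt_j /(chain_above_step noethR (ideal_initial j)) /(_ (mem_generator lt_j)).
by apply: chain_above_mono => x /initial_idealS.
Qed.

(** Each of the [k] remaining generators costs a chain at most one step, and only [m] lies above all
    of them. *)
Lemma chain_initial_bound k j n : (j + k)%N = size s ->
  chain_above (initial_ideal j) n mP -> (n <= k)%N.
Proof.
elim: k j n => [|k IH] j [|n] // jk.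
  rewrite addn0 in jk; case=> _ [q [_ nmq /chain_above_sub Iq]].
  by exfalso; apply: nmq => x mx; apply: Iq; rewrite jk; apply/initial_ideal_full.
move=> /chain_initial_step h; rewrite ltnS; apply: (IH j.+1).
  by rewrite addSnnS.
by apply: h; rewrite -jk addnS ltnS leq_addr.
Qed.

Hypothesis chain_m : chain_above (fun x => x = 0) (size s) mP.

Lemma chain_initial k j : (j + k)%N = size s ->
  chain_above (initial_ideal j) k mP.
Proof.
elim: j k => [|j IH] k jk.
  move: chain_m; rewrite -jk add0n; apply: chain_above_mono => x [c ->].
  by rewrite big_ord0.
apply: chain_initial_step; first by rewrite -jk leq_addr.
by apply: IH; rewrite -addSnnS.
Qed.

(** Descending induction from [m]. A prime [p0] at the bottom of a longest chain over the initial
    ideal is shown to equal it: the length bounds locate [p0] under the next initial ideal, and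
    Nakayama removes the rest. *)
Lemma initial_prime k j : (j + k)%N = size s ->
  is_prime (initial_ideal j) /\ ((j < size s)%N -> ~ initial_ideal j s`_j).
Proof.
elim: k j => [|k IH] j jk.
  rewrite addn0 in jk; rewrite jk ltnn; split=> //.
  rewrite (_ : initial_ideal _ = mP); first exact: local_prime.
  by apply/funext => x; apply/propext; exact: initial_ideal_full.
have lt_j : (j < size s)%N by rewrite -jk addnS ltnS leq_addr.
have jk' : (j.+1 + k)%N = size s by rewrite addSnnS.
have [p0 [pr0 Ip0 ch0]] := chain_above_bottom (chain_initial jk).
have [id0 _ prod0] := pr0.
(* Otherwise the whole chain would lie over the next initial ideal, where it is one step too
   long. *)
have nx : ~ p0 s`_j.
  move=> p0x; suff : (k.+1 <= k)%N by rewrite ltnn.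
  apply: (chain_initial_bound jk'); apply: chain_above_mono ch0 => x /initial_idealS.
  by apply: idealD_sub => //; exact: principal_sub.
have [p1 [pr1 Ip1 ch1]] :=
  chain_above_bottom (chain_above_step noethR id0 ch0 (mem_generator lt_j)).
have Ij1 x : initial_ideal j.+1 x -> p1 x.
  move=> /initial_idealS[y /Ip0 py [z xz ->]]; apply: Ip1.
  by exists y => //; exists z.
(* The next initial ideal is prime by induction; strictly below [p1] it would lengthen the chain
   beyond the bound. *)
have p1I : forall x, p1 x -> initial_ideal j.+1 x.
  apply: contrapT => np1; suff : (k.+1 <= k)%N by rewrite ltnn.
  apply: (chain_initial_bound jk').
  by apply: (chain_above_extend (IH _ jk').1 _ Ij1 np1 ch1).
(* An element of [p0] is an element of the initial ideal plus [b] times the next generator. That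
   generator is not in the prime [p0], so [b] is, and Nakayama applies. *)
have p0I x : p0 x -> initial_ideal j x.
  move=> px; apply: local_sat; first exact: ideal_initial.
  apply: (nakayama noethR local_prime (N := p0) (K := principal s`_j)) px => //.
  - exact: ideal_initial.
  - have [idm _] := local_ideal.
    exact: (@principal_sub _ _ mP idm (mem_generator lt_j)).
  move=> T idT IT xT y py; apply: sub_sat; first exact: local_prime.
  have /p1I/initial_idealS[i Ii [_ [b ->] yE]] : p1 y.
    by apply/Ip1/idealDl => //; exact: ideal_principal.
  rewrite yE; apply: (submodD idT); first exact: IT.
  rewrite mulrC; apply: xT; first exact: principal_id.
  have : p0 (b * s`_j).
    rewrite (_ : b * _ = y - i); first by apply: (submodB id0) => //; exact: Ip0.
    by rewrite yE; ring.
  by case/prod0.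
have E : initial_ideal j = p0.
  by apply/funext => x; apply/propext; split; [exact: Ip0|exact: p0I].
by rewrite E.
Qed.

Lemma initial_regular j a : (j < size s)%N ->
  initial_ideal j (s`_j * a) -> initial_ideal j a.
Proof.
move=> lt_j; have [[_ _ h] nIj] := initial_prime (subnKC (ltnW lt_j)).
by case/h => // /(nIj lt_j).
Qed.

End RegularSequence.

Lemma prime_chain_above (R : comNzRingType) (m : {pred R}) (d : nat)
    (p : nat -> {pred R}) :
  noetherian R -> local_ring m -> prime_chain d p ->
  chain_above (fun x => x = 0) d (fun x => x \in m).
Proof.
move=> noethR localR [pr_p lt_p].
have prime i : (i <= d)%N -> is_prime (fun x => x \in p i).
  move=> /pr_p[id_p pr]; have [idp np1] := idealrW id_p.
  split=> //; first exact/negP.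
  by move=> x y /pr/orP.
have ch i : (i <= d)%N -> chain_above (fun x => x = 0) i (fun x => x \in p i).
  elim: i => [|i IH] le_i; split; try exact: prime.
    by move=> x ->; have [/submod0] := prime 0%N le_i.
  have [sub nsub] := lt_p i le_i.
  exists (fun x => x \in p i); split=> //; exact/IH/ltnW.
apply: chain_above_top (ch d (leqnn d)); first exact: local_prime.
have [idp np1 _] := prime d (leqnn d).
exact: proper_sub_max.
Qed.

(** * Syzygies and global dimension *)

Section Generation.
Variable R : comNzRingType.
Implicit Types A B C : lmodType R.

Definition spans A (s : seq A) (N : A -> Prop) := forall x, N x <->
  exists c : nat -> R, x = \sum_(i < size s) c i *: s`_i.

Lemma spans_min A (s : seq A) (N S : A -> Prop) : spans s N -> is_submodule S ->
  (forall t, t \in s -> S t) -> forall x, N x -> S x.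
Proof.
move=> sN subS sS x /sN[c ->]; apply: (submod_sum subS) => i _.
by apply: (submodZ subS); apply: sS; apply: mem_nth.
Qed.

Lemma spans_mem A (s : seq A) (N : A -> Prop) t : spans s N -> t \in s -> N t.
Proof.
move=> sN ts; apply/sN; exists (fun i => (i == index t s)%:R).
have lt_t : (index t s < size s)%N by rewrite index_mem.
rewrite (bigD1 (Ordinal lt_t)) //= eqxx scale1r nth_index // big1 ?addr0 // => i ne.
by rewrite -(inj_eq val_inj) /= in ne; rewrite (negPf ne) scale0r.
Qed.

Lemma spans_exists A (s : seq A) :
  spans s (fun x => exists c : nat -> R, x = \sum_(i < size s) c i *: s`_i) /\
  is_submodule (fun x => exists c : nat -> R, x = \sum_(i < size s) c i *: s`_i).
Proof.
split=> //; split; first by exists (fun=> 0); rewrite big1 // => i _; rewrite scale0r.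
move=> a _ _ [c ->] [c' ->]; exists (fun i => a * c i + c' i).
rewrite scaler_sumr -big_split; apply: eq_bigr => i _ /=.
by rewrite scalerDl scalerA.
Qed.

Lemma spansP A (s : seq A) (N : A -> Prop) : is_submodule N ->
  (forall t, t \in s -> N t) ->
  (forall S, is_submodule S -> (forall t, t \in s -> S t) -> forall x, N x -> S x) ->
  spans s N.
Proof.
move=> subN sN minN x; have [spS subS] := spans_exists s.
split=> [Nx|]; last exact: spans_min spS subN sN _.
by apply: (minN _ subS) Nx => t; exact: spans_mem spS.
Qed.

(** The first coordinates of [N] form an ideal. Lifts of its generators, with generators of the part
    of [N] whose first coordinate is zero, span [N]. *)
Lemma row_submodule_fg n (N : 'rV[R]_n -> Prop) :
  noetherian R -> is_submodule N -> exists s, spans s N.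
Proof.
move=> noethR; elim: n N => [|n IH] N subN.
  exists [::]; apply: spansP => // S subS _ x _.
  by rewrite (_ : x = 0); [exact: submod0 subS|apply/rowP => -[]].
pose I (r : R) := exists2 x : 'rV_n.+1, N x & x 0 0 = r.
have idI : ideal I.
  split; first by exists 0; rewrite ?mxE //; exact: submod0 subN.
  move=> a _ _ [x Nx <-] [y Ny <-]; exists (a *: x + y); first exact: subN.2.
  by rewrite !mxE.
have [s sI] := ideal_fg noethR idI.
have sI' : @spans R^o s I by [].
pose cons0 (y : 'rV[R]_n) : 'rV_n.+1 := \row_j if unlift 0 j is Some k then y 0 k else 0.
have cons0_lin : linear cons0.
  move=> a x y; apply/rowP => j; rewrite !mxE.
  by case: unlift => [k|]; rewrite ?mxE // mulr0 addr0.
have [c0 c0E] := exists_linear cons0_lin.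
have [t tN] := IH (fun y => N (c0 y)) (ker_submodule c0 subN).
have [h hP] : exists h : R -> 'rV_n.+1, forall r, r \in s -> N (h r) /\ h r 0 0 = r.
  suff /choice[h hP] : forall r, exists x, r \in s -> N x /\ x 0 0 = r by exists h.
  move=> r; have [rs|] := boolP (r \in s); last by exists 0.
  by have [x Nx xr] := spans_mem sI' rs; exists x.
exists (map h s ++ map c0 t); apply: spansP => //.
  move=> y; rewrite mem_cat => /orP[|] /mapP[z zs ->]; first by case: (hP z zs).
  exact: spans_mem tN zs.
move=> S subS hS x Nx.
have [y [Sy Ny yx]] : exists y, [/\ S y, N y & y 0 0 = x 0 0].
  pose T (r : R^o) := exists y, [/\ S y, N y & y 0 0 = r].
  suff sub_T : forall r, I r -> T r by apply: sub_T; exists x.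
  apply: (spans_min sI').
  - split; first by exists 0; rewrite mxE; split=> //; exact: submod0.
    move=> a _ _ [y [Sy Ny <-]] [z [Sz Nz <-]]; exists (a *: y + z).
    by rewrite !mxE; split=> //; [exact: subS.2|exact: subN.2].
  - move=> r rs; exists (h r); have [Nr hr] := hP r rs; split=> //.
    by apply: hS; rewrite mem_cat map_f.
have [z zE] : exists z, c0 z = x - y.
  exists (\row_j ((x - y : 'rV[R]_n.+1) 0 (fintype.lift 0 j))); rewrite c0E.
  apply/rowP => j; rewrite mxE.
  by case: unliftP => [k|] ->; rewrite ?mxE // yx subrr.
rewrite -[x](subrK y); apply: (submodD subS) => //; rewrite -zE.
apply: (spans_min tN (ker_submodule c0 subS)); last first.
  by rewrite zE; exact: submodB.
by move=> u ut; apply: hS; rewrite mem_cat map_f ?orbT.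
Qed.

End Generation.

(** * Minimal resolutions over the local ring *)

Section Syzygies.
Variables (R : comNzRingType) (m : {pred R}) (s : seq R).
Hypothesis noethR : noetherian R.
Hypothesis localR : local_ring m.
Hypothesis gen_m : generates s m.
Hypothesis chain_m : chain_above (fun x => x = 0) (size s) (fun x => x \in m).
Implicit Types A B C : lmodType R.

(** Take as few generators as possible: a relation with a unit coefficient would make one of them
    redundant. *)
Lemma minimal_cover n (N : 'rV[R]_n -> Prop) : is_submodule N ->
  exists k (f : {linear 'rV[R]_k -> 'rV[R]_n}),
    (forall y, N y <-> exists x, f x = y) /\
    forall x, f x = 0 -> forall i, x 0 i \in m.
Proof.
move=> subN; have [t0 t0N] := row_submodule_fg noethR subN.
have ex : exists k, `[< exists2 t, size t = k & spans t N >].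
  by exists (size t0); apply/asboolP; exists t0.
have [k /asboolP[t <- tN] min_k] := ex_minnP ex.
have [f fE] := exists_row_map (fun i : 'I_(size t) => t`_i).
exists (size t), f; split=> [y|x fx0 j].
  rewrite tN; split=> [[c ->]|[x <-]].
    by exists (\row_i c i); rewrite fE; apply: eq_bigr => i _; rewrite mxE.
  exists (fun i => if insub i is Some j then x 0 j else 0); rewrite fE.
  by apply: eq_bigr => i _; rewrite valK.
apply: contrapT => /negP/(local_unit noethR localR)[v vx].
pose t' := take j t ++ drop j.+1 t.
have szt' : (size t' < size t)%N.
  rewrite size_cat size_drop size_take ltn_ord -ltn_subRL.
  by rewrite subnS prednK ?subn_gt0.
suff /asboolT/min_k : exists2 u, size u = size t' & spans u N by rewrite leqNgt szt'.
exists t' => //.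
have other i : i != j -> t`_i \in t'.
  rewrite mem_cat -(inj_eq val_inj) /= neq_ltn => /orP[lt_ij|lt_ji].
    by rewrite -(nth_take 0 lt_ij) mem_nth // size_take ltn_ord.
  rewrite -(subnKC lt_ji) -nth_drop mem_nth ?orbT // size_drop.
  exact: ltn_sub2r (leq_ltn_trans lt_ji (ltn_ord i)) (ltn_ord i).
apply: spansP => //.
  move=> u; rewrite mem_cat => ut; apply: spans_mem tN _.
  by case/orP: ut => [/mem_take|/mem_drop].
move=> S subS t'S; apply: (spans_min tN subS) => u /(nthP 0)[i lt_i <-].
have [ij|ne] := eqVneq (Ordinal lt_i) j; last exact: t'S (other _ ne).
rewrite -[i]/(val (Ordinal lt_i)) ij -[t`_j]scale1r -vx -scalerA.
move: fx0; rewrite fE (bigD1 j) //= => /eqP; rewrite addr_eq0 => /eqP->.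
apply/(submodZ subS)/(submodN subS)/(submod_sum subS) => l ne.
exact/(submodZ subS)/t'S/other.
Qed.

(* The submodule (s`_0, ..., s`_(j-1)) N. *)
Fixpoint initial_mul A j (N : A -> Prop) : A -> Prop := match j with
  | 0 => fun x => x = 0
  | j'.+1 => fun x => exists b c,
      [/\ initial_mul j' N b, N c & x = b + s`_j' *: c]
  end.

Lemma initial_mul_submodule A j (N : A -> Prop) :
  is_submodule N -> is_submodule (initial_mul j N).
Proof.
move=> subN; elim: j => [|j IH] /=; first exact: zero_submodule.
split.
  exists 0, 0; rewrite scaler0 addr0; split=> //; exact: submod0.
move=> a _ _ [b [c [Ib Nc ->]]] [b' [c' [Ib' Nc' ->]]].
exists (a *: b + b'), (a *: c + c'); split; [exact: IH.2|exact: subN.2|].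
by rewrite !scalerDr !scalerA addrACA mulrC.
Qed.

Lemma initial_mul_sub A j (N N' : A -> Prop) :
  (forall x, N x -> N' x) -> forall x, initial_mul j N x -> initial_mul j N' x.
Proof.
move=> NN'; elim: j => [//|j IH] x [b [c [Ib Nc ->]]].
by exists b, c; split=> //; [exact: IH|exact: NN'].
Qed.

Lemma initial_mul_image A B j (f : {linear A -> B}) (N : B -> Prop) :
  (forall y, N y <-> exists x, f x = y) ->
  forall y, initial_mul j N y <->
    exists2 x, initial_mul j (fun _ => True) x & f x = y.
Proof.
move=> fN; elim: j => [|j IH] y /=.
  by split=> [->|[x -> <-]]; [exists 0; rewrite ?linear0|rewrite linear0].
split=> [[_ [_ [/IH[b Ib <-] /fN[c <-] ->]]]|[_ [b [c [Ib _ ->]]] <-]].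
  by exists (b + s`_j *: c); [exists b, c|rewrite linearD linearZ].
exists (f b), (f c); split; rewrite ?linearD ?linearZ //; last by apply/fN; exists c.
by apply/IH; exists b.
Qed.

Lemma initial_mul_row n j (x : 'rV[R]_n) :
  initial_mul j (fun _ => True) x <-> forall i, initial_ideal s j (x 0 i).
Proof.
elim: j x => [|j IH] x /=.
  split=> [->|h]; first by move=> i; exists (fun=> 0); rewrite mxE big_ord0.
  by apply/rowP => i; have [c ->] := h i; rewrite big_ord0 mxE.
split=> [[b [c [/IH Ib _ ->]]] i|h].
  apply/initial_idealS; exists (b 0 i) => //.
  by exists (s`_j * c 0 i); [exists (c 0 i); rewrite mulrC|rewrite !mxE].
have /choice[bc bcE] : forall i, exists bc : R * R,
    initial_ideal s j bc.1 /\ x 0 i = bc.1 + s`_j * bc.2.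
  move=> i; have /initial_idealS[b Ib [_ [c ->] xi]] := h i.
  by exists (b, c); rewrite xi mulrC.
exists (\row_i (bc i).1), (\row_i (bc i).2); split=> //.
  by apply/IH => i; rewrite mxE; have [] := bcE i.
by apply/rowP => i; rewrite !mxE; have [] := bcE i.
Qed.

(* s`_0, ..., s`_(j-1) is a regular sequence on the quotient by N. *)
Definition quotient_regular n j (N : 'rV[R]_n -> Prop) := forall i x b c,
  (i < j)%N -> initial_mul i (fun _ => True) b -> N c -> s`_i *: x = b + c ->
  exists b' c', [/\ initial_mul i (fun _ => True) b', N c' & x = b' + c'].

Lemma row_regular n j (x : 'rV[R]_n) : (j < size s)%N ->
  initial_mul j (fun _ => True) (s`_j *: x) -> initial_mul j (fun _ => True) x.
Proof.
move=> lt_j /initial_mul_row h; apply/initial_mul_row => i.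
by have := h i; rewrite mxE; exact: (initial_regular noethR localR gen_m chain_m lt_j).
Qed.

(** With I the ideal of the first [i] generators and F the free module, (IF meet N)/IN is Tor_1(R/I,
    F/N). Regularity kills it: the last coefficient [c] is replaced by an element of [N], and the
    remainder involves one generator less. *)
Lemma initial_mul_cap n j (N : 'rV[R]_n -> Prop) i x : is_submodule N ->
  quotient_regular j N -> (i <= j)%N ->
  initial_mul i (fun _ => True) x -> N x -> initial_mul i N x.
Proof.
move=> subN regN; elim: i x => [//|i IH] x le_i [b [c [Ib _ xE]]] Nx.
have subI := initial_mul_submodule i (full_submodule 'rV[R]_n).
have [|b' [n' [Ib' Nn' cE]]] := regN i c (- b) x le_i (submodN subI Ib) Nx.
  by rewrite xE addKr.
have yE : x - s`_i *: n' = b + s`_i *: b' by rewrite xE cE scalerDr addrA addrK.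
exists (x - s`_i *: n'), n'; rewrite subrK; split=> //; apply: IH; first exact: ltnW.
  by rewrite yE; apply: (submodD subI) => //; exact: submodZ.
by apply: (submodB subN) => //; exact: submodZ.
Qed.

(** The quotient by the kernel is [N], a submodule of a free module on which the whole sequence is
    regular. The intersection lemma holds up to [i = j], and this is where one more generator is
    gained. *)
Lemma quotient_regular_ker n k j (f : {linear 'rV[R]_k -> 'rV[R]_n})
    (N : 'rV[R]_n -> Prop) : is_submodule N -> (j < size s)%N ->
  (forall y, N y <-> exists x, f x = y) ->
  quotient_regular j N -> quotient_regular j.+1 (fun x => f x = 0).
Proof.
move=> subN lt_j fN regN i x b c; rewrite ltnS => le_i Ib fc0 xE.
have INb : initial_mul i N (f b) by apply/(initial_mul_image _ fN); exists b.
have Ifx : initial_mul i (fun _ => True) (f x).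
  apply: row_regular; first exact: leq_ltn_trans lt_j.
  rewrite -linearZ xE linearD fc0 addr0.
  exact: initial_mul_sub INb.
have /(initial_mul_image _ fN)[b' Ib' fb'] : initial_mul i N (f x).
  by apply: (initial_mul_cap subN regN) => //; apply/fN; exists x.
by exists b', (x - b'); rewrite addrCA subrr addr0 linearB fb' subrr.
Qed.

(** The intersection lemma gives N = mN. In a minimal cover a basis vector would then differ from an
    element of the kernel by a vector with entries in [m], forcing 1 into [m]. *)
Lemma quotient_regular_max n (N : 'rV[R]_n -> Prop) : is_submodule N ->
  quotient_regular (size s) N -> (forall x, N x -> forall i, x 0 i \in m) ->
  forall x, N x -> x = 0.
Proof.
move=> subN regN Nm.
have [k [f [fN fm]]] := minimal_cover subN.
have full (k' : nat) (x : 'rV[R]_k') :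
    initial_mul (size s) (fun _ => True) x <-> forall i, x 0 i \in m.
  by rewrite initial_mul_row; split=> h i; apply/(initial_ideal_full gen_m).
move=> x /fN[y <-]; rewrite (row_map_sum f) big1 // => i _; exfalso.
have Nfi : N (f (delta_mx 0 i)) by apply/fN; exists (delta_mx 0 i).
have : initial_mul (size s) N (f (delta_mx 0 i)).
  by apply: (initial_mul_cap subN regN) => //; apply/full; exact: Nm.
move=> /(initial_mul_image _ fN)[b /full/(_ i) bm fb].
have [idm] := local_ideal localR; apply.
have := fm (delta_mx 0 i - b); rewrite linearB fb subrr => /(_ erefl i).
rewrite !mxE !eqxx /= => mb.
by have := submodD idm mb bm; rewrite /= subrK.
Qed.

Fixpoint nth_cosyzygy k A : Prop := match k with
  | 0 => True
  | k'.+1 => exists2 B, cosyzygy B A & nth_cosyzygy k' B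
  end.

(** After [k] more syzygies the module is free, so Ext^(k+1) of the quotient by [N] vanishes;
    shifting turns this into Ext^1 with values in a [k]-th cosyzygy. *)
Lemma extends_along_cover k j n (N : 'rV[R]_n -> Prop) : (j + k)%N = size s ->
  is_submodule N -> quotient_regular j N -> (forall x, N x -> forall i, x 0 i \in m) ->
  exists n' (f : {linear 'rV[R]_n' -> 'rV[R]_n}),
    (forall y, N y <-> exists x, f x = y) /\
    forall C, nth_cosyzygy k C -> extends_along f C.
Proof.
elim: k j n N => [|k IH] j n N jk subN regN Nm;
  have [n' [f [fN fm]]] := minimal_cover subN; exists n', f; split=> //.
  move=> C _ phi ker; rewrite addn0 in jk; subst j.
  have N0 := quotient_regular_max subN regN Nm.
  exists \0 => x /=; rewrite ker //; apply/N0/fN; by exists x.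
have lt_j : (j < size s)%N by rewrite -jk addnS ltnS leq_addr.
have subK := ker_submodule f (zero_submodule _).
have [|||n'' [f' [f'E ext]]] := IH j.+1 n' (fun x => f x = 0) _ subK.
- by rewrite addSnnS.
- exact: quotient_regular_ker fN regN.
- exact: fm.
- move=> C [B BC /ext extB]; apply: extends_along_cosyzygy BC _ extB => //.
  exact: row_projective.
Qed.

Lemma nth_cosyzygy_injective C : nth_cosyzygy (size s) C -> injective_module C.
Proof.
move=> cosyzC; apply: baer_injective => G G0 G_lin G_fun.
(* For the unit ideal the value at 1 is the answer. A proper ideal lies in [m], as the resolution
   started with [j = 0] requires. *)
have [[e Ge]|nG1] := pselect (exists e, G 1 e).
  exists e => r x Gr; apply/eqP; rewrite -subr_eq0; apply/eqP/G_fun.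
  by have := G_lin (- r) _ _ _ _ Ge Gr; rewrite mulr1 addNr scaleNr addrC.
have G_uniq r x y : G r x -> G r y -> x = y.
  move=> Gx Gy; apply/eqP; rewrite -subr_eq0; apply/eqP/G_fun.
  by have := G_lin (- 1) _ _ _ _ Gy Gx; rewrite mulN1r addNr scaleN1r addrC.
pose N (v : 'rV[R]_1) := exists x, G (v 0 0) x.
have subN : is_submodule N.
  split; first by exists 0; rewrite mxE.
  by move=> a u v [x Gx] [y Gy]; exists (a *: x + y); rewrite !mxE; exact: G_lin.
have idG : ideal (fun r => exists x, G r x).
  split; first by exists 0.
  by move=> a u v [x Gx] [y Gy]; exists (a *: x + y); exact: G_lin.
have [|||n [f [fN ext]]] := @extends_along_cover (size s) 0 1 N _ subN.
- by rewrite add0n.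
- by [].
- move=> v Nv i; rewrite (ord1 i); exact: (proper_sub_max noethR localR idG nG1).
have /choice[g gE] : forall v, exists x, G (f v 0 0) x.
  by move=> v; apply/fN; exists v.
have g_lin : linear g.
  move=> a x y; apply: G_uniq (gE _) _; rewrite linearP !mxE.
  exact: G_lin.
have [phi phiE] := exists_linear g_lin.
have [|psi psiE] := ext C cosyzC phi.
  move=> x fx0; rewrite phiE; apply: G_fun; have := gE x.
  by rewrite fx0 mxE.
exists (psi (const_mx 1)) => r x Gr.
have /fN[v vE] : N (const_mx r) by exists x; rewrite mxE.
rewrite -linearZ (_ : r *: _ = f v).
  by rewrite psiE phiE; apply: G_uniq Gr _; have := gE v; rewrite vE mxE.
by rewrite vE; apply/rowP => i; rewrite !mxE mulr1.
Qed.

End Syzygies.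

(** * From injective to projective dimension, for subquotients *)

Section Resolutions.
Variable R : comNzRingType.
Implicit Types A C E P S X Y : lmodType R.

Fixpoint id_le n C : Prop := match n with
  | 0 => injective_module C
  | n'.+1 => exists2 C', cosyzygy C C' & id_le n' C'
  end.

(* Z and B stand for the subquotient Z/B of A, without forming quotient modules:
   P maps onto Z modulo B, and the next syzygy is the preimage of B in P. *)
Fixpoint pd_subquotient n A (Z B : A -> Prop) : Prop :=
  exists P (p : {linear P -> A}),
    [/\ projective P, forall t, Z (p t), forall z, Z z -> exists t, B (z - p t) &
    match n with
    | 0 => forall t, B (p t) -> t = 0
    | n'.+1 => pd_subquotient n' (fun t => B (p t)) (fun t => t = 0)
    end].

(* Dually, Z/B embeds into E, and the next cosyzygy is E modulo the image of Z. *)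
Fixpoint id_subquotient n A (Z B : A -> Prop) : Prop :=
  exists E (e : {linear A -> E}),
    [/\ injective_module E, forall b, B b -> e b = 0,
        forall z, Z z -> e z = 0 -> B z &
    match n with
    | 0 => forall y, exists2 z, Z z & e z = y
    | n'.+1 => id_subquotient n' (fun _ => True) (fun y => exists2 z, Z z & e z = y)
    end].

Variable d : nat.
Hypothesis cosyzygies_injective : forall C, nth_cosyzygy d C -> injective_module C.

Lemma all_id_le C : id_le d C.
Proof.
suff h n k D : (k + n)%N = d -> nth_cosyzygy k D -> id_le n D by exact: (h d 0%N).
elim: n k D => [|n IH] k D kn cD.
  by rewrite addn0 in kn; apply: cosyzygies_injective; rewrite -kn.
have [C' DC'] := enough_cosyzygies D; exists C' => //.
by apply: (IH k.+1); [rewrite addSnnS|exists D].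
Qed.

(** Here [S] is Z and [C] is Z/B. Passing through A/B, the injectivity of the first term extends the
    map from Z to all of [A], as maps out of a complex need. *)
Lemma id_le_subquotient n S C A (i : {linear S -> A}) (p : {linear S -> C})
    (Z B : A -> Prop) :
  is_submodule Z -> is_submodule B ->
  (forall x, Z x <-> exists t, i t = x) -> (forall c, exists t, p t = c) ->
  (forall t, p t = 0 <-> B (i t)) -> id_le n C -> id_subquotient n Z B.
Proof.
elim: n S C A i p Z B => [|n IH] S C A i p Z B subZ subB iZ surj_p kerp idC.
  have [Q [q [_ kerq]]] := quotient_exists subB.
  have [|e eE] := injective_extends idC (f := q \o i : {linear _ -> _}) (phi := p).
    by move=> t /kerq/kerp.
  exists C, (e \o q : {linear _ -> _}); split=> //=.
  - by move=> b /kerq->; rewrite linear0.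
  - by move=> z /iZ[t <-]; have /= -> := eE t; move/kerp.
  - by move=> y; have [t <-] := surj_p y; exists (i t); [apply/iZ; exists t|exact: eE].
have [C' [E [io [pi [injE inj_io surj_pi kerpi]]]] idC'] := idC.
have [Q [q [_ kerq]]] := quotient_exists subB.
have [|e eE] := injective_extends injE (f := q \o i : {linear _ -> _})
    (phi := io \o p : {linear _ -> _}).
  by move=> t /kerq/kerp /= ->; rewrite linear0.
exists E, (e \o q : {linear _ -> _}); split=> //=.
- by move=> b /kerq->; rewrite linear0.
- move=> z /iZ[t <-]; have /= -> := eE t => iopt; apply/kerp/inj_io.
  by rewrite iopt linear0.
- apply: (IH E C' E idfun pi) => //.
  + exact: (image_submodule (e \o q : {linear _ -> _}) subZ).
  + by move=> x; split=> // _; exists x.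
  + move=> y; rewrite kerpi /=; split.
      move=> [c <-]; have [t <-] := surj_p c.
      by exists (i t); [apply/iZ; exists t|have /= -> := eE t].
    by move=> [_ /iZ[t <-] <-]; exists (p t); have /= -> := eE t.
Qed.

Lemma all_id_subquotient A (Z B : A -> Prop) : is_submodule Z -> is_submodule B ->
  id_subquotient d Z B.
Proof.
move=> subZ subB; have [S [i [_ iZ]]] := submodule_exists subZ.
have [C [p [surj_p kerp]]] := quotient_exists (ker_submodule i subB).
exact: id_le_subquotient subZ subB iZ surj_p kerp (all_id_le C).
Qed.

(** Extending the identity of the image of [f] splits it off [Y]; the complement is the required
    projective module, a copy of the cokernel. *)
Lemma extends_along_all_split X Y (f : {linear X -> Y}) :
  (forall C, extends_along f C) -> projective Y ->
  exists P (j : {linear P -> Y}), [/\ projective P,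
    forall u x, j u = f x -> u = 0 & forall y, exists u x, y = j u + f x].
Proof.
move=> ext projY.
have [I [i [inj_i iE]]] := submodule_exists (image_submodule f (full_submodule X)).
have [|q qE] := @linear_factor_mono _ _ _ _ f i inj_i.
  by move=> x; apply/iE; exists x.
have qs y : exists x, q x = y.
  have /iE[x _ xy] : exists m, i m = i y by exists y.
  by exists x; apply: inj_i; rewrite qE.
have [|psi psiE] := ext I q.
  by move=> x fx0; apply: inj_i; rewrite qE fx0 linear0.
have psiK y : psi (i y) = y by have [x <-] := qs y; rewrite qE psiE.
have [P [j [inj_j jE]]] := submodule_exists (ker_submodule psi (zero_submodule I)).
have lin : linear (fun y => y - i (psi y)).
  by move=> a x y; rewrite !linearP /= scalerDr addrACA.
have [g gE] := exists_linear lin.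
have [|r rE] := @linear_factor_mono _ _ _ _ g j inj_j.
  by move=> y; apply/jE; rewrite gE linearB /= psiK subrr.
have psij u : psi (j u) = 0 by apply/jE; exists u.
exists P, j; split.
- apply: (@retract_projective _ _ _ j r _ projY) => u.
  by apply: inj_j; rewrite rE gE psij linear0 subr0.
- move=> u x ju; have := psij u; rewrite ju psiE => qx0.
  by apply: inj_j; rewrite ju -qE qx0 !linear0.
- move=> y; have [x qx] := qs (psi y); exists (r y), x.
  by rewrite rE gE -qE qx subrK.
Qed.

(** [k] syzygies have been taken, and [f] has the extension property for targets of injective
    dimension at most [k]. At [k = d] these are all modules, so the cokernel is projective and the
    resolution stops. *)
Lemma extends_along_subquotient n k X1 X0 A (f : {linear X1 -> X0})
    (p : {linear X0 -> A}) (Z B : A -> Prop) :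
  (k + n)%N = d -> is_submodule B -> projective X1 -> projective X0 ->
  (forall C, id_le k C -> extends_along f C) ->
  (forall t, Z (p t)) -> (forall z, Z z -> exists t, B (z - p t)) ->
  (forall t, B (p t) <-> exists x, f x = t) -> pd_subquotient n Z B.
Proof.
elim: n k X1 X0 A f p Z B => [|n IH] k X1 X0 A f p Z B kn subB pr1 pr0 ext Zp surj kerp.
  rewrite addn0 in kn; subst k.
  have [P [j [prP jf jD]]] :=
    extends_along_all_split (fun C => ext C (all_id_le C)) pr0.
  exists P, (p \o j : {linear _ -> _}); split=> //=.
    move=> z /surj[t Bt]; have [u [x tE]] := jD t; exists u.
    rewrite (_ : z - _ = (z - p t) + p (f x)).
      by apply: (submodD subB) => //; apply/kerp; exists x.
    by rewrite tE linearD /= opprD addrA subrK.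
  by move=> u /kerp[x /esym]; exact: jf.
exists X0, p; split=> //.
have [K [i [inj_i iE]]] := submodule_exists (ker_submodule f (zero_submodule X0)).
have [X2 [q [pr2 surj_q]]] := enough_projectives K.
have ex : exact_at (i \o q : {linear _ -> _}) f.
  move=> x; rewrite iE; split=> [[y <-]|[y <-]]; last by exists (q y).
  by have [z <-] := surj_q y; exists z.
apply: (IH k.+1 X2 X1 X0 (i \o q : {linear _ -> _}) f) => //.
- by rewrite addSnnS.
- exact: zero_submodule.
- move=> C [C' CC' idC']; apply: (extends_along_syzygy ex CC' pr0).
  exact: ext.
- by move=> t; apply/kerp; exists t.
- by move=> z /kerp[t <-]; exists t; rewrite subrr.
Qed.

Lemma all_pd_subquotient A (Z B : A -> Prop) : is_submodule Z -> is_submodule B ->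
  (forall x, B x -> Z x) -> pd_subquotient d Z B.
Proof.
move=> subZ subB BZ.
have cover (A' : lmodType R) (S : A' -> Prop) : is_submodule S ->
    exists P (p : {linear P -> A'}), projective P /\ forall x, S x <-> exists t, p t = x.
  move=> subS; have [M [i [_ iE]]] := submodule_exists subS.
  have [P [p [prP surj_p]]] := enough_projectives M.
  exists P, (i \o p : {linear _ -> _}); split=> // x; rewrite iE.
  split=> [[y <-]|[t <-]]; last by exists (p t).
  by have [t <-] := surj_p y; exists t.
have [X0 [p [pr0 pE]]] := cover _ _ subZ.
have [X1 [f [pr1 fE]]] := cover _ _ (ker_submodule p subB).
apply: (@extends_along_subquotient d 0 X1 X0 A f p) => //.
- by move=> C; exact: injective_extends.
- by move=> t; apply/pE; exists t.
- by move=> z /pE[t <-]; exists t; rewrite subrr; exact: submod0.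
Qed.

End Resolutions.

(** * Complexes and levels *)

Section Homology.
Variable R : comNzRingType.
Implicit Types X Y Z : complex R.

Lemma pred_int_ind (T : int -> Prop) : (forall j, T (j - 1)) -> forall i, T i.
Proof. by move=> h i; rewrite -(addrK 1 i). Qed.

Lemma cycleP X i (x : X i) : cycle x <-> differential X i (i - 1) x = 0.
Proof.
split=> [|dx j]; first exact.
by case: (eqVneq j (i - 1)) => [->//|ne]; rewrite differential_shape.
Qed.

Lemma boundaryP X j (x : X (j - 1)) :
  boundary x <-> exists y : X j, differential X j (j - 1) y = x.
Proof.
split=> [[k [y <-]]|[y <-]]; last by exists j, y.
case: (eqVneq k j) y => [->|ne] y; first by exists y.
exists 0; rewrite linear0 differential_shape //.
by apply: contra_neq ne => /addIr->.
Qed.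

Lemma cycle_submodule X i : is_submodule (@cycle R X i).
Proof.
split=> [j|a x y cx cy j]; first by rewrite linear0.
by rewrite linearP cx cy scaler0 addr0.
Qed.

Lemma boundary_submodule X i : is_submodule (@boundary R X i).
Proof.
elim/pred_int_ind: i => j; split; first by apply/boundaryP; exists 0; rewrite linear0.
move=> a _ _ /boundaryP[x <-] /boundaryP[y <-]; apply/boundaryP.
by exists (a *: x + y); rewrite linearP.
Qed.

Lemma boundary_cycle X i (x : X i) : boundary x -> cycle x.
Proof. by move=> [j [y <-]] k; rewrite differentialK. Qed.

Lemma quasi_isoP X Y (f : chain_map X Y) :
  (forall j, (forall (x : X (j - 1)) (y : Y j),
       cycle x -> f (j - 1) x = differential Y j (j - 1) y -> boundary x) /\
     (forall y : Y (j - 1), cycle y ->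
       exists2 x : X (j - 1), cycle x & boundary (f (j - 1) x - y))) ->
  quasi_iso f.
Proof.
move=> h i; elim/pred_int_ind: i => j; have [inj surj] := h j; split.
  move=> x x' cx cx' /boundaryP[y dy]; apply: (inj _ y).
    exact: (submodB (cycle_submodule _ _) cx cx').
  by rewrite linearB dy.
by move=> y /surj[x cx bx]; exists x.
Qed.

Lemma bijective_quasi_iso X Y (f : chain_map X Y) :
  (forall i, injective (f i)) -> (forall i y, exists x, f i x = y) -> quasi_iso f.
Proof.
move=> inj surj; apply: quasi_isoP => j; split.
  move=> x y _; have [z <-] := surj j y; rewrite -componentE => /inj->.
  by apply/boundaryP; exists z.
move=> y cy; have [x xy] := surj _ y; exists x.
  by move=> k; apply: inj; rewrite componentE xy cy linear0.
by rewrite xy subrr; exact: submod0 (boundary_submodule _ _).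
Qed.

Lemma quasi_iso_isom X Y (f : chain_map X Y) : quasi_iso f -> d_isom (dmap f).
Proof.
by move=> qf; exists (dinv qf); split; [exact: deq_invl|exact: deq_invr].
Qed.

Lemma quasi_iso_isomorphic X Y (f : chain_map X Y) : quasi_iso f -> d_isomorphic X Y.
Proof. by move=> qf; exists (dmap f); exact: quasi_iso_isom. Qed.

Lemma quasi_iso_isomorphicV X Y (f : chain_map X Y) :
  quasi_iso f -> d_isomorphic Y X.
Proof.
move=> qf; exists (dinv qf), (dmap f).
by split; [exact: deq_invr|exact: deq_invl].
Qed.

Lemma did_isom X : d_isom (did X).
Proof. by exists (did X); split; exact: deq_idl. Qed.

End Homology.

Section Triangles.
Variable R : comNzRingType.
Implicit Types K L M N X : complex R.

Lemma zero_complex_eq0 i (x : zero_complex R i) : x = 0.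
Proof.
move: x; rewrite /zero_complex /stalk /= /stalk_obj.
by case: ifP => _ x; exact: zero_module_eq0.
Qed.

Section AddZero.
Variable M : complex R.
Let Z := zero_complex R.

Definition dsum_snd : chain_map (dsum Z M) M :=
  @ChainMap R (dsum Z M) M (fun i => snd : {linear (Z i * M i)%type -> M i})
    (fun i j x => erefl).

Let inr i (x : M i) : (Z i * M i)%type := (0, x).

Let inr_linear i : linear (@inr i).
Proof. by move=> a x y; congr pair; rewrite /= scaler0 addr0. Qed.

HB.instance Definition _ i :=
  GRing.isLinear.Build R (M i) (Z i * M i)%type _ (@inr i) (@inr_linear i).

Let inr_subproof i j (x : M i) :
  inr (differential M i j x) = differential (dsum Z M) i j (inr x).
Proof. by []. Qed.

Definition dsum_inr : chain_map M (dsum Z M) :=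
  @ChainMap R M (dsum Z M) (fun i => @inr i) inr_subproof.

Lemma dsum_snd_quasi_iso : quasi_iso dsum_snd.
Proof.
apply: bijective_quasi_iso => [i [a x] [b y] /= ->|i y]; last by exists (0, y).
by rewrite (zero_complex_eq0 a) (zero_complex_eq0 b).
Qed.

End AddZero.

(** The summand [L] in the definition of [thick] is taken to be zero. *)
Lemma thick_cone (C : complex R -> Prop) K M N (f : chain_map K M) n :
  d_isomorphic N (cone f) -> thick1 C K -> thick C n.+1 N -> thick C n.+2 M.
Proof.
move=> [c isom_c] tK tN; have [c' [cc' c'c]] := isom_c.
exists K, (zero_complex R), N, (dmap (comp_map (dsum_inr M) f)),
  (dcomp c' (dcomp (dmap (cone_in f)) (dmap (dsum_snd M)))),
  (dcomp (dmap (cone_out f)) c).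
split=> //; exists K, M, f, (did K), (dmap (dsum_snd M)), c; split.
  split=> //; first exact: did_isom.
  exact/quasi_iso_isom/dsum_snd_quasi_iso.
split.
- apply: deq_trans (deq_sym (deq_idr _)).
  apply: deq_trans (deq_sym (deq_map_comp _ _)) _.
  exact: deq_map.
- apply: deq_trans (deq_assoc _ _ _) _.
  apply: deq_trans (deq_comp c'c (deq_refl _)) _.
  exact: deq_idl.
- apply: deq_trans (deq_comp _ (deq_refl _)) (deq_idl _).
  exact: deq_map.
Qed.

End Triangles.

Section Graded.
Variable R : comNzRingType.

Definition graded (P : int -> lmodType R) : complex R :=
  @Complex R P (fun i j => \0 : {linear P i -> P j})
    (fun i j x _ => erefl) (fun i j k x => erefl).

Lemma graded_map_subproof (P : int -> lmodType R) (X : complex R)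
    (p : forall i, {linear P i -> X i}) :
  (forall i t, cycle (p i t)) ->
  forall i j x, p j (differential (graded P) i j x) = differential X i j (p i x).
Proof. by move=> cp i j x; rewrite cp linear0. Qed.

Definition graded_map (P : int -> lmodType R) (X : complex R) (p : forall i, {linear P i -> X i})
    (cp : forall i t, cycle (p i t)) : chain_map (graded P) X :=
  @ChainMap R (graded P) X p (graded_map_subproof cp).

(** Induction on the list of degrees, splitting off one shifted stalk at a time. *)
Lemma graded_thick1 (c : lmodType R -> Prop) (P : int -> lmodType R) (s : seq int) :
  c (zero_module R) -> (forall i, c (P i)) ->
  (forall i, i \notin s -> forall x : P i, x = 0) ->
  thick1 (in_degree_zero c) (graded P).
Proof.
move=> c0; elim: s P => [|j s IH] P cP P0.
  apply: thick1_iso (thick1_zero _).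
  have cp i (t : P i) : @cycle R (zero_complex R) i ((\0 : {linear P i -> zero_complex R i}) t).
    exact: submod0 (cycle_submodule _ _).
  apply: (quasi_iso_isomorphicV (f := graded_map cp)).
  apply: bijective_quasi_iso => [i x y _|i y]; first by rewrite (P0 i _ x) // (P0 i _ y).
  by exists 0; rewrite (zero_complex_eq0 y) linear0.
pose P' i := if i == j then zero_module R else P i.
(* The source is built from conditional expressions, so the isomorphisms are obtained by cases in
   each degree and then chosen. *)
have h i : exists f : {linear (stalk_obj (P j) (i - j) * P' i)%type -> P i},
    injective f /\ forall y, exists x, f x = y.
  rewrite /stalk_obj /P' subr_eq0; have [->|ne] := eqVneq i j.
    exists fst; split=> [[x a] [y b] /= ->|y]; last by exists (y, 0).
    by rewrite (zero_module_eq0 a) (zero_module_eq0 b).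
  exists snd; split=> [[a x] [b y] /= ->|y]; last by exists (0, y).
  by rewrite (zero_module_eq0 a) (zero_module_eq0 b).
pose L i := sval (cid (h i)).
have [injL surjL] : (forall i, injective (L i)) /\ forall i y, exists x, L i x = y.
  by split=> i; have [] := svalP (cid (h i)).
pose D := dsum (shift j (stalk (P j))) (graded P').
have fE i k x : L k (differential D i k x) = differential (graded P) i k (L i x).
  rewrite /= (_ : dsum_diff _ _ = 0) ?linear0 //.
  by congr pair; rewrite /= /shift_diff scaler0.
have qf : quasi_iso (@ChainMap R D (graded P) L fE) by exact: bijective_quasi_iso.
apply: thick1_iso (quasi_iso_isomorphic qf) _.
apply: thick1_sum.
  by apply/thick1_shift/thick1_in; exists (P j).
apply: IH => [i|i is_]; first by rewrite /P'; case: ifP.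
rewrite /P'; case: eqVneq => [_ x|ne]; first exact: zero_module_eq0.
by apply: P0; rewrite inE negb_or ne.
Qed.

End Graded.

(** * Projective levels, by cones of covers *)

Section ProjectiveLevel.
Variable R : comNzRingType.
Implicit Types X Y : complex R.

Definition homology_support X (s : seq int) :=
  forall i (x : X i), i \notin s -> cycle x -> boundary x.

Lemma bounded_homology_support X :
  bounded_homology X -> exists s, homology_support X s.
Proof.
case=> n bn; exists [seq k%:Z - n%:Z | k <- iota 0 (n.*2.+1)] => i x ni.
apply: bn; rewrite ltnNge; apply: contra ni => le_in.
apply/mapP; exists (absz (i + n%:Z)); last by lia.
by rewrite mem_iota; lia.
Qed.

Lemma pd_subquotient_trivial n (A : lmodType R) (Z B : A -> Prop) :
  is_submodule B -> Z 0 -> (forall z, Z z -> B z) -> pd_subquotient n Z B.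
Proof.
move=> subB Z0 ZB; elim: n A Z B subB Z0 ZB => [|n IH] A Z B subB Z0 ZB;
  exists (zero_module R), \0; split=> //=; try exact: zero_projective.
- by move=> z /ZB Bz; exists 0; rewrite subr0.
- by move=> t _; exact: zero_module_eq0.
- by move=> z /ZB Bz; exists 0; rewrite subr0.
- apply: IH; [exact: zero_submodule|exact: submod0|].
  by move=> t _; exact: zero_module_eq0.
Qed.

(** Outside the support the cover is chosen to be zero, so that only finitely many shifted
    projectives are used. *)
Lemma pd_subquotient_homology n X (s : seq int) :
  homology_support X s ->
  (forall i, pd_subquotient n (@cycle R X i) (@boundary R X i)) ->
  exists (P : int -> lmodType R) (p : forall i, {linear P i -> X i}), forall i,
    [/\ projective (P i), i \notin s -> forall t : P i, t = 0,
      forall t, cycle (p i t), forall z, cycle z -> exists t, boundary (z - p i t) &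
      match n with
      | 0 => forall t, boundary (p i t) -> t = 0
      | n'.+1 => pd_subquotient n' (fun t => boundary (p i t)) (fun t => t = 0)
      end].
Proof.
move=> suppX resX.
suff h i : exists (P : lmodType R) (p : {linear P -> X i}),
    [/\ projective P, i \notin s -> forall t : P, t = 0,
      forall t, cycle (p t), forall z, cycle z -> exists t, boundary (z - p t) &
      match n with
      | 0 => forall t, boundary (p t) -> t = 0
      | n'.+1 => pd_subquotient n' (fun t => boundary (p t)) (fun t => t = 0)
      end].
  exists (fun i => sval (cid (h i))), (fun i => sval (cid (svalP (cid (h i))))) => i.
  exact: svalP (cid (svalP (cid (h i)))).
have [is_|nis] := boolP (i \in s).
  have : exists (P : lmodType R) (p : {linear P -> X i}), [/\ projective P, forall t, cycle (p t),
      forall z, cycle z -> exists t, boundary (z - p t) &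
      match n with
      | 0 => forall t, boundary (p t) -> t = 0
      | n'.+1 => pd_subquotient n' (fun t => boundary (p t)) (fun t => t = 0)
      end] by case: (n) (resX i).
  by case=> P [p [*]]; exists P, p.
exists (zero_module R), \0; split=> //=.
- exact: zero_projective.
- by move=> _ t; exact: zero_module_eq0.
- by move=> t; exact: submod0 (cycle_submodule _ _).
- by move=> z /(suppX _ _ nis) bz; exists 0; rewrite subr0.
- case: (n) => [|n'] => [t _|]; first exact: zero_module_eq0.
  apply: pd_subquotient_trivial; first exact: zero_submodule.
    exact: submod0 (boundary_submodule _ _).
  by move=> t _; exact: zero_module_eq0.
Qed.

Section ConeOfCover.
Variables (X : complex R) (P : int -> lmodType R) (p : forall i, {linear P i -> X i}).
Hypothesis cycle_p : forall i t, cycle (p i t).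
Let f := graded_map cycle_p.

Lemma cone_graded_cycle j (x : cone f j) :
  cycle x <-> differential X j (j - 1) x.2 + p (j - 1) x.1 = 0.
Proof.
rewrite cycleP /= /cone_diff transport_id /=.
split=> [[]//|E]; congr pair => //=.
by rewrite /shift_diff /= scaler0.
Qed.

Lemma cone_graded_boundary j (x : cone f (j - 1)) :
  boundary x <-> x.1 = 0 /\ exists z w, x.2 = differential X j (j - 1) z + p (j - 1) w.
Proof.
rewrite boundaryP /= /cone_diff; split=> [[[w z] <-]|[x1 [z [w x2]]]] /=.
  by rewrite /shift_diff scaler0 transport_id; split=> //; exists z, w.
exists (w, z); rewrite transport_id /= -x2 /shift_diff scaler0 -x1.
by case: (x).
Qed.

Hypothesis surj_p : forall i (z : X i), cycle z -> exists t, boundary (z - p i t).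

(** Surjectivity on homology makes the homology of the cone embed into [P] by the first component;
    its image is the first syzygy. *)
Lemma cone_graded_boundary0 j (x : cone f (j - 1)) :
  cycle x -> boundary x <-> x.1 = 0.
Proof.
move=> cx; rewrite cone_graded_boundary; split=> [[]//|x1]; split=> //.
have : cycle x.2.
  by apply/cycleP; move/cone_graded_cycle: cx; rewrite x1 linear0 addr0.
move=> /surj_p[w /boundaryP[z dz]]; exists z, w.
by rewrite dz subrK.
Qed.

Lemma pd_subquotient_cone n i :
  (forall i, pd_subquotient n (fun t => boundary (p i t)) (fun t => t = 0)) ->
  pd_subquotient n (@cycle R (cone f) i) (@boundary R (cone f) i).
Proof.
elim/pred_int_ind: i => j res.
have [P' [q [prP' qB surj_q rest]]] : exists (P' : lmodType R) (q : {linear P' -> P (j - 1 - 1)}),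
    [/\ projective P', forall t, boundary (p _ (q t)),
    forall z, boundary (p _ z) -> exists t, z - q t = 0 &
    match n with
    | 0 => forall t, q t = 0 -> t = 0
    | n'.+1 => pd_subquotient n' (fun t => q t = 0) (fun t => t = 0)
    end] by case: (n) (res (j - 1 - 1)).
have [|h hE] := @projective_lift _ _ _ _ (differential X (j - 1) (j - 1 - 1))
    (p (j - 1 - 1) \o q : {linear _ -> _}) prP'.
  by move=> t; exact/boundaryP/qB.
(* A cover of the syzygy is lifted to cycles of the cone; the cycle condition d x_2 + p x_1 = 0
   dictates the sign. *)
have lin : linear (fun t => (q t, - h t) : cone_obj (graded P) X (j - 1)).
  by move=> a x y; congr pair; rewrite ?linearP // opprD -scalerN.
have [g gE] := exists_linear lin.
have cg t : @cycle R (cone f) (j - 1) (g t).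
  by apply/cone_graded_cycle; rewrite gE /= linearN hE addNr.
have bg t : @boundary R (cone f) (j - 1) (g t) <-> q t = 0.
  by rewrite cone_graded_boundary0 // gE.
have sg z : @cycle R (cone f) (j - 1) z ->
    exists t, @boundary R (cone f) (j - 1) (z - g t).
  move=> cz; have [|t qt] := surj_q z.1.
    apply/boundaryP; exists (- z.2); move/cone_graded_cycle: cz => /eqP.
    by rewrite addr_eq0 linearN => /eqP->; rewrite opprK.
  exists t; apply/cone_graded_boundary0; last by rewrite gE.
  exact: (submodB (cycle_submodule (cone f) (j - 1)) cz (cg t)).
case: (n) rest => [|n'] rest; exists P', g; split=> //.
  by move=> t /bg/rest.
rewrite (_ : (fun t => _) = (fun t => q t = 0)) //.
by apply/funext => t; apply/propext; exact: bg.
Qed.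

End ConeOfCover.

Lemma cone_graded_support X (P : int -> lmodType R)
    (p : forall i, {linear P i -> X i}) (cycle_p : forall i t, cycle (p i t)) s :
  homology_support X s -> (forall i, i \notin s -> forall t : P i, t = 0) ->
  homology_support (cone (graded_map cycle_p)) (s ++ [seq i + 1 | i <- s]).
Proof.
move=> suppX P0 i; elim/pred_int_ind: i => j x.
rewrite mem_cat negb_or => /andP[js js1] /cone_graded_cycle.
have x1 : x.1 = 0.
  by apply: P0; apply: contra js1 => h; apply/mapP; exists (j - 1 - 1); rewrite ?subrK.
rewrite x1 linear0 addr0 => /cycleP cx.
apply/cone_graded_boundary; split=> //.
have /boundaryP[z dz] := suppX _ _ js cx.
by exists z, 0; rewrite linear0 addr0.
Qed.

Lemma projective_thick n X (s : seq int) :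
  homology_support X s ->
  (forall i, pd_subquotient n (@cycle R X i) (@boundary R X i)) ->
  thick (in_degree_zero (@projective R)) n.+1 X.
Proof.
elim: n X s => [|n IH] X s suppX resX;
  have [P [p h]] := pd_subquotient_homology suppX resX.
all: have cp i t : cycle (p i t) by have [] := h i.
all: have tP : thick1 (in_degree_zero (@projective R)) (graded P)
    by apply: (graded_thick1 (s := s)) => [|i|i]; [exact: zero_projective|case: (h i)|
       case: (h i)].
  apply: thick1_iso tP; apply: (quasi_iso_isomorphic (f := graded_map cp)).
  apply: quasi_isoP => j; have [_ _ _ surj_p inj_p] := h (j - 1); split.
    move=> x y _ /= px; rewrite (inj_p x); first exact: submod0 (boundary_submodule _ _).
    by apply/boundaryP; exists y.
  move=> y /surj_p[t bt]; exists t => //=.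
  by have := submodN (boundary_submodule _ _) bt; rewrite opprB.
apply: (thick_cone (f := graded_map cp) (N := cone (graded_map cp))) => //.
  by exists (did _); exact: did_isom.
apply: (IH _ (s ++ [seq i + 1 | i <- s])).
  by apply: cone_graded_support => // i; have [] := h i.
move=> i; apply: pd_subquotient_cone => k; by have [] := h k.
Qed.

End ProjectiveLevel.

Section ChainMaps.
Variable R : comNzRingType.
Implicit Types X Y Z : complex R.

Lemma exists_chain_map X Y (f : forall i, X i -> Y i) : (forall i, linear (f i)) ->
  (forall j x, f (j - 1) (differential X j (j - 1) x) =
     differential Y j (j - 1) (f j x)) ->
  exists g : chain_map X Y, forall i x, g i x = f i x.
Proof.
move=> lf df; pose F i := sval (cid (exists_linear (lf i))).
have FE i x : F i x = f i x by exact: svalP (cid (exists_linear (lf i))) x.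
have FD i j x : F j (differential X i j x) = differential Y i j (F i x).
  have [->|ne] := eqVneq j (i - 1); first by rewrite !FE df.
  by rewrite !differential_shape // linear0.
by exists (@ChainMap R X Y F FD).
Qed.

(* The octahedral axiom for a composite of chain maps: the cone of the map
   cone g -> cone (f g) is quasi-isomorphic to cone f. *)
Lemma cone_comp X Y Z (f : chain_map Y Z) (g : chain_map X Y) :
  exists (phi : chain_map (cone g) (cone (comp_map f g)))
    (psi : chain_map (cone phi) (cone f)), quasi_iso psi.
Proof.
have [|j [x y]|phi phiE] := @exists_chain_map (cone g) (cone (comp_map f g))
  (fun i p => (p.1, f i p.2)).
- by move=> i a p q; rewrite /= linearP.
- by rewrite /= /cone_diff /= !transport_id linearD /= componentE.
(* The two copies of [X] form a contractible part, and what remains is the cone of [f]; the term in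
   [g] makes [psi] commute with the differentials. *)
have [|j [[x' y] [x z]]|psi psiE] := @exists_chain_map (cone phi) (cone f)
  (fun i p => (p.1.2 + g (i - 1) p.2.1, p.2.2)).
- by move=> i a p q; congr pair; rewrite /= linearP scalerDr addrACA.
- rewrite /= /cone_diff /= !transport_id phiE /=.
  rewrite /shift_diff /= /cone_diff /= /shift_diff /= !expr1 !scaleN1r.
  congr pair; last by rewrite linearD addrA addrAC.
  by rewrite !linearD /= linearN /= addrACA addNr addr0 componentE.
exists phi, psi; apply: quasi_isoP => j; split.
  move=> [[x' y] [x z]] [y1 z1] /cycleP; rewrite psiE /= /cone_diff /= !transport_id.
  rewrite phiE /= /shift_diff /= /cone_diff /= /shift_diff /= !expr1 !scaleN1r.
  rewrite !transport_id => -[_ _ /eqP]; rewrite addr_eq0 => /eqP/oppr_inj x'E _ [yE zE].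
  apply/boundaryP; exists (x, y1, (0, z1)).
  rewrite /= /cone_diff /= !transport_id phiE /=.
  rewrite /shift_diff /= /cone_diff /= /shift_diff /= !expr1 !scaleN1r !transport_id.
  congr (_, _, (_, _)).
  - by rewrite x'E opprK.
  - by rewrite opprD -yE addrK.
  - by rewrite linear0 oppr0 add0r.
  - by rewrite !linear0 addr0.
move=> [y z] /cycleP; rewrite /= /cone_diff /= /shift_diff /= expr1 scaleN1r.
rewrite transport_id => -[/eqP]; rewrite oppr_eq0 => /eqP dy dz.
exists (0, y, (0, z)).
  apply/cycleP; rewrite /= /cone_diff /= !transport_id phiE /=.
  rewrite /shift_diff /= /cone_diff /= /shift_diff /= !expr1 !scaleN1r !transport_id.
  congr (_, _, (_, _)).
  - by rewrite linear0 !oppr0.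
  - by rewrite dy add0r !linear0.
  - by rewrite linear0 oppr0 add0r.
  - by rewrite !linear0 addr0 dz.
rewrite psiE /= linear0 addr0 subrr.
exact: submod0 (boundary_submodule _ _).
Qed.

End ChainMaps.

(** * Injective levels, by homotopy fibres *)

Section InjectiveLevel.
Variable R : comNzRingType.
Implicit Types X Y : complex R.

Lemma succ_int_ind (T : int -> Prop) : (forall k, T (k + 1)) -> forall i, T i.
Proof. by move=> h i; rewrite -(subrK 1 i). Qed.

Lemma cycle_succP X k (x : X (k + 1)) :
  cycle x <-> differential X (k + 1) k x = 0.
Proof.
rewrite cycleP; suff : (k + 1) - 1 = k by move->.
by rewrite addrK.
Qed.

Lemma boundary_succP X k (x : X k) :
  boundary x <-> exists y : X (k + 1), differential X (k + 1) k y = x.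
Proof.
split=> [[i [y <-]]|[y <-]]; last by exists (k + 1), y.
case: (eqVneq i (k + 1)) y => [->|ne] y; first by exists y.
exists 0; rewrite linear0 differential_shape //.
by apply: contra_neq ne => ->; rewrite subrK.
Qed.

Lemma transport_boundary X i j (x : X i) : boundary x -> boundary (transport j x).
Proof.
have [<-|ne] := eqVneq i j; first by rewrite transport_id.
by rewrite transport_neq // => _; exact: submod0 (boundary_submodule _ _).
Qed.

Lemma zero_injective : injective_module (zero_module R).
Proof.
by move=> A B g f _; exists \0 => x /=; rewrite (zero_module_eq0 (f x)).
Qed.

Lemma id_subquotient_trivial n (A : lmodType R) (Z B : A -> Prop) :
  Z 0 -> (forall z, Z z -> B z) -> id_subquotient n Z B.
Proof.
elim: n A Z B => [|n IH] A Z B Z0 ZB; exists (zero_module R), \0; split=> //=;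
  try exact: zero_injective.
- by move=> z /ZB.
- by move=> y; exists 0 => //; rewrite (zero_module_eq0 y).
- by move=> z /ZB.
- by apply: IH => // z _; exists 0; rewrite // (zero_module_eq0 z).
Qed.

Lemma id_subquotient_homology n X (s : seq int) :
  homology_support X s ->
  (forall i, id_subquotient n (@cycle R X i) (@boundary R X i)) ->
  exists (E : int -> lmodType R) (e : forall i, {linear X i -> E i}), forall i,
    [/\ injective_module (E i), i \notin s -> forall t : E i, t = 0,
      forall b, boundary b -> e i b = 0, forall z, cycle z -> e i z = 0 -> boundary z &
      match n with
      | 0 => forall y, exists2 z, cycle z & e i z = y
      | n'.+1 => id_subquotient n' (fun _ => True) (fun y => exists2 z, cycle z & e i z = y)
      end].
Proof.
move=> suppX resX.
suff h i : exists (E : lmodType R) (e : {linear X i -> E}),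
    [/\ injective_module E, i \notin s -> forall t : E, t = 0,
      forall b, boundary b -> e b = 0, forall z, cycle z -> e z = 0 -> boundary z &
      match n with
      | 0 => forall y, exists2 z, cycle z & e z = y
      | n'.+1 => id_subquotient n' (fun _ => True) (fun y => exists2 z, cycle z & e z = y)
      end].
  exists (fun i => sval (cid (h i))), (fun i => sval (cid (svalP (cid (h i))))) => i.
  exact: svalP (cid (svalP (cid (h i)))).
have [is_|nis] := boolP (i \in s).
  have : exists (E : lmodType R) (e : {linear X i -> E}),
    [/\ injective_module E,
      forall b, boundary b -> e b = 0, forall z, cycle z -> e z = 0 -> boundary z &
      match n with
      | 0 => forall y, exists2 z, cycle z & e z = y
      | n'.+1 => id_subquotient n' (fun _ => True) (fun y => exists2 z, cycle z & e z = y)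
      end] by case: (n) (resX i).
  by case=> E [e [*]]; exists E, e.
have c0 : cycle (0 : X i) by exact: submod0 (cycle_submodule _ _).
exists (zero_module R), \0; split=> //=.
- exact: zero_injective.
- by move=> _ t; exact: zero_module_eq0.
- by move=> z /(suppX _ _ nis).
- case: (n) => [|n'] => [y|]; first by exists 0; rewrite // (zero_module_eq0 y).
  by apply: id_subquotient_trivial => // y _; exists 0; rewrite // (zero_module_eq0 y).
Qed.

(* E (i + 1) sits in degree i of the homotopy fibre of e. *)
Section Fibre.
Variables (X : complex R) (E : int -> lmodType R) (e : forall i, {linear X i -> E i}).
Hypothesis eB : forall i b, boundary b -> e i b = 0.

Definition fibre_obj i : lmodType R := (X i * E (i + 1))%type.

Definition fibre_diff i j (x : fibre_obj i) : fibre_obj j :=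
  (differential X i j x.1, e (j + 1) (transport (j + 1) x.1)).

Lemma fibre_diff_linear i j : linear (@fibre_diff i j).
Proof. by move=> a x y; rewrite /fibre_diff /= !linearP. Qed.

HB.instance Definition _ i j :=
  GRing.isLinear.Build R (fibre_obj i) (fibre_obj j) _
    (@fibre_diff i j) (@fibre_diff_linear i j).

Lemma fibre_shape i j (x : fibre_obj i) : j != i - 1 -> fibre_diff j x = 0.
Proof.
move=> ne; rewrite /fibre_diff differential_shape // transport_neq ?linear0 //.
by apply: contra_neq ne => ->; rewrite addrK.
Qed.

Lemma fibre_diffK i j k (x : fibre_obj i) : fibre_diff k (fibre_diff j x) = 0.
Proof.
congr pair; first exact: differentialK.
by apply/eB/transport_boundary; exists i, x.1.
Qed.

Definition fibre : complex R :=
  @Complex R fibre_obj (fun i j => @fibre_diff i j) fibre_shape fibre_diffK.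

Definition fibre_fst : chain_map fibre X :=
  @ChainMap R fibre X (fun i => fst : {linear fibre_obj i -> X i})
    (fun i j x => erefl).

(** The two copies of [X] in the cone cancel. The index [i - 1 + 1] is the one at which the shifted
    fibre presents [E], so only elements of [X] are transported. *)
Lemma cone_fibre_fst :
  exists f : chain_map (cone fibre_fst) (graded (fun i => E (i - 1 + 1))),
    quasi_iso f.
Proof.
have [|j [[x y] z]|f fE] := @exists_chain_map R (cone fibre_fst)
  (graded (fun i => E (i - 1 + 1)))
  (fun i p => p.1.2 + e (i - 1 + 1) (transport (i - 1 + 1) p.2)).
- by move=> i a p q; rewrite /= !linearP /= scalerDr addrACA.
- rewrite /= /cone_diff /= transport_id /= /shift_diff /= /fibre_diff expr1 scaleN1r /=.
  rewrite !linearD /= addrCA addNr addr0.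
  by apply/eB/transport_boundary; exists j, z.
exists f; apply: quasi_isoP => j; split.
  move=> [[x y] z] w /cycleP; rewrite fE /= /cone_diff /= transport_id.
  move=> [_ _ /eqP]; rewrite addr_eq0 => /eqP dz.
  move=> /eqP; rewrite addr_eq0 => /eqP yE.
  apply/boundaryP; exists (z, 0, 0).
  rewrite /= /cone_diff /= transport_id /= /shift_diff /= /fibre_diff expr1 scaleN1r /=.
  congr (_, _, _); first by rewrite dz opprK.
    by rewrite yE.
  by rewrite linear0 add0r.
move=> y _; exists (0, y, 0).
  apply/cycleP; rewrite /= /cone_diff /= transport_id /= /shift_diff /= /fibre_diff /=.
  by rewrite !linear0 addr0.
rewrite fE /= !linear0 addr0 subrr.
exact: submod0 (boundary_submodule _ _).
Qed.

Hypothesis eZ : forall i z, cycle z -> e i z = 0 -> boundary z.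

Lemma fibre_cycle k (p : fibre (k + 1)) : cycle p -> boundary p.1.
Proof.
move=> /cycle_succP; rewrite /= /fibre_diff transport_id => -[dx ex].
by apply: eZ => //; apply/cycle_succP.
Qed.

Lemma fibre_boundary k (p : fibre k) : boundary p <-> exists x : X (k + 1),
  p = (differential X (k + 1) k x, e (k + 1) x).
Proof.
rewrite boundary_succP /= /fibre_diff; split=> [[[x y] <-]|[x ->]].
  by exists x; rewrite transport_id.
by exists (x, 0); rewrite transport_id.
Qed.

Lemma fibre_support s : homology_support X s ->
  (forall i, i \notin s -> forall t : E i, t = 0) ->
  homology_support fibre (s ++ [seq i - 1 | i <- s]).
Proof.
move=> suppX E0 i; elim/succ_int_ind: i => k [x y].
rewrite mem_cat negb_or => /andP[ks ks1] /fibre_cycle/boundary_succP[z /= dz].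
apply/fibre_boundary; exists z; rewrite dz; congr pair.
have E0' : forall t : E (k + 1 + 1), t = 0.
  by apply: E0; apply: contra ks1 => h; apply/mapP; exists (k + 1 + 1); rewrite ?addrK.
by rewrite [LHS]E0' [RHS]E0'.
Qed.

(** The homology of the fibre in degree [k + 1] is the next cosyzygy, [E] modulo the image of the
    cycles in degree [k + 2]. The map [q] on [E] becomes q y - h x on the fibre, where [h] extends
    [q e] along the differential, so that boundaries (d x, e x) are killed. *)
Lemma id_subquotient_fibre n i : (forall i, injective_module (E i)) ->
  (forall i, id_subquotient n (fun _ => True)
     (fun y : E i => exists2 z, cycle z & e i z = y)) ->
  id_subquotient n (@cycle R fibre i) (@boundary R fibre i).
Proof.
move=> injE; elim/succ_int_ind: i => k res.
have [E' [q [injE' q0 q_inj rest]]] : exists (E' : lmodType R) (q : {linear E (k + 1 + 1) -> E'}),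
    [/\ injective_module E',
      forall y, (exists2 z, cycle z & e (k + 1 + 1) z = y) -> q y = 0,
      forall y, q y = 0 -> exists2 z, cycle z & e (k + 1 + 1) z = y &
    match n with
    | 0 => forall y, exists z, q z = y
    | n'.+1 => id_subquotient n' (fun _ => True) (fun y => exists z, q z = y)
    end].
  case: (n) (res (k + 1 + 1)) => [|n'] [E' [q [injE' q0 q_inj rest]]]; exists E', q.
    split=> //; first by move=> y; exact: q_inj.
    by move=> y; have [z _ <-] := rest y; exists z.
  split=> //; first by move=> y; exact: q_inj.
  suff -> : (fun y => exists z, q z = y) = (fun y => exists2 z, True & q z = y) by [].
  by apply/funext => y; apply/propext; split=> [[z <-]|[z _ <-]]; exists z.
have [|h hE] := injective_extends injE' (f := differential X (k + 1 + 1) (k + 1))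
    (phi := q \o e (k + 1 + 1) : {linear _ -> _}).
  by move=> x /cycle_succP cx /=; apply: q0; exists x.
have lin : linear (fun p : fibre (k + 1) => q p.2 - h p.1).
  by move=> a x y; rewrite !linearP /= scalerDr addrACA.
have [g gE] := exists_linear lin.
have c0 y : @cycle R fibre (k + 1) (0, y).
  by move=> j; rewrite /= /fibre_diff /= !linear0.
have g_im w : (exists z, q z = w) <-> exists2 z, @cycle R fibre (k + 1) z & g z = w.
  split=> [[y <-]|[[x y] cxy <-]].
    by exists (0, y); rewrite // gE /= linear0 subr0.
  have /boundary_succP[x' /= dx'] := fibre_cycle cxy.
  by exists (y - e (k + 1 + 1) x'); rewrite gE /= -dx' hE /= linearB.
have gB b : @boundary R fibre (k + 1) b -> g b = 0.
  by move=> /fibre_boundary[x ->]; rewrite gE /= hE subrr.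
have gZ z : @cycle R fibre (k + 1) z -> g z = 0 -> @boundary R fibre (k + 1) z.
  case: z => x y cxy; rewrite gE /=.
  have /boundary_succP[x' /= <-] := fibre_cycle cxy.
  rewrite hE /= -linearB => /q_inj[z /cycle_succP cz /eqP].
  rewrite eq_sym subr_eq => /eqP yE; apply/fibre_boundary; exists (z + x').
  by rewrite !linearD /= cz add0r yE.
case: (n) rest => [|n'] rest; exists E', g; split=> //.
  by move=> y; apply/g_im.
suff -> : (fun w => exists2 z, @cycle R fibre (k + 1) z & g z = w) =
  (fun w => exists z, q z = w) by [].
by apply/funext => y; apply/propext; split=> /g_im.
Qed.

End Fibre.

Local Notation inj := (in_degree_zero (@injective_module R)).

Lemma injective_graded_thick1 (E : int -> lmodType R) (r : int -> int) (s s' : seq int) :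
  (forall i, injective_module (E i)) ->
  (forall i, i \notin s -> forall t : E i, t = 0) ->
  (forall i, i \notin s' -> r i \notin s) ->
  thick1 inj (graded (fun i => E (r i))).
Proof.
move=> injE E0 rs; apply: (graded_thick1 (s := s')) => //; first exact: zero_injective.
by move=> i /rs; exact: E0.
Qed.

Lemma injective_thick1 X (s : seq int) : homology_support X s ->
  (forall i, id_subquotient 0 (@cycle R X i) (@boundary R X i)) -> thick1 inj X.
Proof.
move=> suppX /(id_subquotient_homology suppX)[E [e h]].
have [|j x|f fE] := @exists_chain_map R X (graded E) (fun i => e i).
- by move=> i a x y; rewrite linearP.
- by have [_ _ eB _ _] := h (j - 1); apply: eB; exists j, x.
apply: (thick1_iso (X := graded E)); last first.
  by apply: (@injective_graded_thick1 E id s s) => // i; have [] := h i.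
apply: (quasi_iso_isomorphicV (f := f)); apply: quasi_isoP => j.
have [_ _ _ eZ surj_e] := h (j - 1); split.
  by move=> x y cx; rewrite fE; exact: eZ.
move=> y _; have [z cz <-] := surj_e y; exists z => //; rewrite fE subrr.
exact: submod0 (boundary_submodule _ _).
Qed.

Lemma injective_step n X (s : seq int) : homology_support X s ->
  (forall i, id_subquotient n.+1 (@cycle R X i) (@boundary R X i)) ->
  exists F (p : chain_map F X) s', [/\ homology_support F s',
    forall i, id_subquotient n (@cycle R F i) (@boundary R F i) &
    thick1 inj (cone p)].
Proof.
move=> suppX /(id_subquotient_homology suppX)[E [e h]].
have injE i : injective_module (E i) by case: (h i).
have E0 i : i \notin s -> forall t : E i, t = 0 by case: (h i).
have eB i b : boundary b -> e i b = 0 by have [_ _ hb _ _] := h i; exact: hb.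
have eZ i z : cycle z -> e i z = 0 -> boundary z.
  by have [_ _ _ hz _] := h i; exact: hz.
exists (fibre eB), (fibre_fst eB), (s ++ [seq i - 1 | i <- s]); split.
- exact: fibre_support.
- by move=> i; apply: id_subquotient_fibre => // l; case: (h l).
have [f qf] := cone_fibre_fst eB.
apply: thick1_iso (quasi_iso_isomorphicV qf) _.
apply: (@injective_graded_thick1 E (fun i => i - 1 + 1) s s) => // i.
by rewrite subrK.
Qed.

(* The definition of thick splits off an object of thick1 at the first vertex
   of a triangle, whereas injective resolutions produce one at the third.  The
   octahedral axiom lets the tower of fibres X_n -> ... -> X_0 = Y be
   read from its other end. *)
Lemma injective_thick_cone n k X Y (s : seq int) (g : chain_map X Y) :
  homology_support X s ->
  (forall i, id_subquotient n (@cycle R X i) (@boundary R X i)) ->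
  thick inj k.+1 (cone g) -> thick inj (n + k).+2 Y.
Proof.
elim: n k X s g => [|n IH] k X s g suppX resX tg.
  apply: (thick_cone (f := g)) (injective_thick1 suppX resX) tg.
  by exists (did _); exact: did_isom.
have [F [p [s' [suppF resF tp]]]] := injective_step suppX resX.
rewrite addSnnS; apply: (IH k.+1 F s' (comp_map g p)) => //.
have [phi [psi qpsi]] := cone_comp g p.
by apply: (thick_cone (f := phi)) tp tg; exact: quasi_iso_isomorphicV qpsi.
Qed.

Lemma injective_thick n X (s : seq int) : homology_support X s ->
  (forall i, id_subquotient n (@cycle R X i) (@boundary R X i)) -> thick inj n.+1 X.
Proof.
case: n => [|n] suppX resX; first exact: injective_thick1 suppX resX.
have [F [p [s' [suppF resF tp]]]] := injective_step suppX resX.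
by have := injective_thick_cone (k := 0) suppF resF tp; rewrite addn0.
Qed.

End InjectiveLevel.

Section Levels.
Variable R : comNzRingType.

Lemma thick1_sub (C C' : complex R -> Prop) M :
  (forall X, C X -> C' X) -> thick1 C M -> thick1 C' M.
Proof.
move=> CC'; elim=> {M} [X /CC'|X Y iso _ h|k X _ h||X Y _ h _ h'|X Y _ h].
- exact: thick1_in.
- exact: thick1_iso iso h.
- exact: thick1_shift.
- exact: thick1_zero.
- exact: thick1_sum.
- exact: thick1_summand h.
Qed.

Lemma thick_sub (C C' : complex R -> Prop) n M :
  (forall X, C X -> C' X) -> thick C n M -> thick C' n M.
Proof.
move=> CC'; elim: n M => [//|[_|n IH]] M; first exact: thick1_sub.
move=> [K [L [N [u [v [w [tri tK tN]]]]]]]; exists K, L, N, u, v, w.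
by split=> //; [exact: thick1_sub tK|exact: IH].
Qed.

Lemma sup_level_le (c : lmodType R -> Prop) n :
  (forall M : complex R, bounded_homology M -> thick (in_degree_zero c) n M) ->
  (sup_level c <= (n%:R)%:E)%E.
Proof.
move=> h; apply: ge_ereal_sup => _ [M /h tM <-].
by apply: ereal_inf_lbound; exists n.
Qed.

End Levels.

Theorem corollary3p4p1 (R : comNzRingType) (m : {pred R}) (d : nat)
  (hR : regular_local_ring m d) :
  [/\ (sup_level (@projective R) <= (d.+1%:R)%:E)%E,
      (sup_level (@injective_module R) <= (d.+1%:R)%:E)%E &
      (sup_level (@flat R) <= (d.+1%:R)%:E)%E].
Proof.
have [noethR localR [[p chain_p] _] [s [szs gen_m]]] := hR.
have chain_m := prime_chain_above noethR localR chain_p.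
(* Global dimension at most [d]: the form in which regularity enters both arguments on complexes. *)
have inj_d (C : lmodType R) : nth_cosyzygy d C -> injective_module C.
  rewrite -szs in chain_m *; exact: (nth_cosyzygy_injective noethR localR gen_m chain_m).
have tP M : bounded_homology M -> thick (in_degree_zero (@projective R)) d.+1 M.
  move=> /bounded_homology_support[t suppM]; apply: projective_thick suppM _ => i.
  apply: all_pd_subquotient => //; first exact: cycle_submodule.
    exact: boundary_submodule.
  exact: boundary_cycle.
split; apply: sup_level_le => M bM; first exact: tP.
  have [t suppM] := bounded_homology_support bM.
  apply: injective_thick suppM _ => i; apply: all_id_subquotient => //.
    exact: cycle_submodule.
  exact: boundary_submodule.
by apply: thick_sub (tP M bM) => _ [P /projective_flat flatP ->]; exists P.
Qed.
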